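(* Let $f=f(x,v)$ and $\psi=\psi(x,v)$ be two functions. For any $x_3\in\mathbb R$, $$\int_{\mathbb R^2}\int_{\mathbb R^3}\langle Q_{FPL}\rangle(f,f)\,\psi\,dv\,d\bar x=-\frac{\omega_c^2}2\sum_{i=1}^4\int_{\mathbb R^2}\int_{\mathbb R^3}\int_{\mathbb R^2}\int_{\mathbb R^3}ff'\,\big(\xi^i\cdot\nabla\ln f-\varepsilon_i(\xi^i)'\cdot\nabla'\ln f'\big)\big(\xi^i\cdot\nabla\psi-\varepsilon_i(\xi^i)'\cdot\nabla'\psi'\big)\,dv'd\bar x'\,dv\,d\bar x,$$ where $f=f(x,v)$, $f'=f(x_1',x_2',x_3,v')$, $\nabla\psi=\nabla_{\omega_cx,v}\psi(x,v)$, $\nabla'\psi'=\nabla_{\omega_cx',v'}\psi(x_1',x_2',x_3,v')$ (same notation for $\ln f$), $\xi^i=\xi^i(\bar x,v,\bar x',v')$, $(\xi^i)'=\xi^i(\bar x',v',\bar x,v)$. In particular the averaged Fokker-Planck-Landau operator satisfies, for every $x_3\in\mathbb R$, the mass, third momentum component and kinetic energy balances (globally in $(x_1,x_2,v)$) $$\int_{\mathbb R^2}\int_{\mathbb R^3}\Big(1,v_3,\frac{|v|^2}2\Big)\langle Q_{FPL}\rangle(f,f)\,dv\,d\bar x=(0,0,0),$$ and decreases the entropy $f\ln f$ (globally in $(x_1,x_2,v)$): $$\int_{\mathbb R^2}\int_{\mathbb R^3}\ln f\,\langle Q_{FPL}\rangle(f,f)\,dv\,d\bar x\le0.$$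
   Context: Notation. $x=(x_1,x_2,x_3)$, $v=(v_1,v_2,v_3)\in\mathbb R^3$, $\bar x=(x_1,x_2)$, $\bar v=(v_1,v_2)$ (likewise $\bar x',\bar v'$), $e_3=(0,0,1)$; for $w=(w_1,w_2)\in\mathbb R^2$, ${}^\perp w=(w_2,-w_1)$ and $(w,0)=(w_1,w_2,0)$. A pair of vectors of $\mathbb R^3$ is a vector of $\mathbb R^6$; $(\xi\otimes\eta)_{kl}=\xi_k\eta_l$. $\omega_c\neq0$ is a constant and $\sigma:\mathbb R_+\to\mathbb R_+$ a given function. $\nabla_{\omega_cx,v}u=(\frac1{\omega_c}\nabla_xu,\nabla_vu)$, $\mathrm{div}_{\omega_cx,v}(\xi_x,\xi_v)=\frac1{\omega_c}\mathrm{div}_x\xi_x+\mathrm{div}_v\xi_v$, and $\nabla_{\omega_cx',v'}$ similarly. Averaged Fokker-Planck-Landau operator, defined for arbitrary $f$ (not necessarily satisfying any constraint): $$\omega_c^{-2}\langle Q_{FPL}\rangle(f,f)(x,v)=\mathrm{div}_{\omega_cx,v}\Big\{\int_{\mathbb R^2}\int_{\mathbb R^3}\sum_{i=1}^4f(\bar x',x_3,v')\,\xi^i(\bar x,v,\bar x',v')\otimes\xi^i(\bar x,v,\bar x',v')\nabla_{\omega_cx,v}f(x,v)\,dv'd\bar x'\Big\}$$ $$-\,\mathrm{div}_{\omega_cx,v}\Big\{\int_{\mathbb R^2}\int_{\mathbb R^3}\sum_{i=1}^4f(x,v)\,\xi^i(\bar x,v,\bar x',v')\otimes\varepsilon_i\xi^i(\bar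 x',v',\bar x,v)\nabla_{\omega_cx',v'}f(\bar x',x_3,v')\,dv'd\bar x'\Big\},$$ $\varepsilon_1=\varepsilon_2=-1$, $\varepsilon_3=\varepsilon_4=1$. Fields: with $r=|\bar v|$, $r'=|\bar v'|$, $z=\omega_c\bar x+{}^\perp\bar v-(\omega_c\bar x'+{}^\perp\bar v')$, $\sigma=\sigma(\sqrt{|z|^2+(v_3-v_3')^2})$, $\chi=\chi(r,r',z)=\frac{\mathbf 1_{\{|r-r'|<|z|<r+r'\}}}{\pi^2\sqrt{|z|^2-(r-r')^2}\sqrt{(r+r')^2-|z|^2}}$, and $\varphi\in(0,\pi)$ given by $|z|^2=r^2+(r')^2-2rr'\cos\varphi$ when $|r-r'|<|z|<r+r'$, the fields $\xi^i=\xi^i(\bar x,v,\bar x',v')\in\mathbb R^6$ are $\xi^1=\{\sigma\chi\}^{1/2}\frac{r'\sin\varphi\,(v_3-v_3')}{|z|\sqrt{|z|^2+(v_3-v_3')^2}}\Big(\frac{(\bar v,0)}{|\bar v|},\frac{({}^\perp\bar v,0)}{|\bar v|}\Big)$, $\xi^2=\{\sigma\chi\}^{1/2}\Big[\frac{r-r'\cos\varphi}{|z|}\Big(\frac{(\bar v,0)}{|\bar v|},\frac{({}^\perp\bar v,0)}{|\bar v|}\Big)+\Big(\frac{({}^\perp z,0)}{|z|},0\Big)\Big]$, $\xi^3=\{\sigma\chi\}^{1/2}\frac{r'\sin\varphi}{|z|}\Big(\frac{({}^\perp\bar v,0)}{|\bar v|},-\frac{(\bar v,0)}{|\bar v|}\Big)$,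 $\xi^4=\{\sigma\chi\}^{1/2}\Big[\frac{(r'\cos\varphi-r)(v_3-v_3')}{|z|\sqrt{|z|^2+(v_3-v_3')^2}}\Big(\frac{({}^\perp\bar v,0)}{|\bar v|},-\frac{(\bar v,0)}{|\bar v|}\Big)+\frac{\big((v_3-v_3')\frac{(z,0)}{|z|},-|z|e_3\big)}{\sqrt{|z|^2+(v_3-v_3')^2}}\Big]$ (zero where $\chi=0$). Regularity convention: $f$ is positive, and $f,\psi$ are smooth with enough decay (of $f$) so that all the integrals and integrations by parts make sense. *)

(* Defs.v *)
From HB Require Import structures.
From mathcomp Require Import all_boot all_order all_algebra.
From mathcomp Require Import all_classical all_reals all_analysis.
From mathcomp Require Import ring lra.

Set Implicit Arguments.
Unset Strict Implicit.
Unset Printing Implicit Defensive.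

Import Order.TTheory GRing.Theory Num.Theory.
Import numFieldNormedType.Exports.

Local Open Scope classical_set_scope.
Local Open Scope ring_scope.

(* Vectors of R^n are column vectors. The library norm on 'cV[R]_n is the sup
   norm, hence the separate Euclidean norm [enorm]. *)
Section vectors.
Context {R : realType}.

Definition dot n (a b : 'cV[R]_n) : R := \sum_k a k 0 * b k 0.

Definition enorm n (a : 'cV[R]_n) : R := Num.sqrt (dot a a).

Definition tens n (a b : 'cV[R]_n) : 'M[R]_n := a *m b^T.

Definition bar (v : 'cV[R]_3) : 'cV[R]_2 := usubmx (v : 'cV[R]_(2 + 1)).

Definition third (v : 'cV[R]_3) : R := v ord_max 0.

Definition perp (w : 'cV[R]_2) : 'cV[R]_2 := \col_k [:: w 1 0; - w 0 0]`_k.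

Definition join3 (w : 'cV[R]_2) (t : R) : 'cV[R]_3 :=
  col_mx w t%:M : 'cV[R]_(2 + 1).

Definition hor (w : 'cV[R]_2) : 'cV[R]_3 := join3 w 0.

Definition e3 : 'cV[R]_3 := join3 0 1.

Definition pair6 (a b : 'cV[R]_3) : 'cV[R]_(3 + 3) := col_mx a b.

Definition vec2 (p : R * R) : 'cV[R]_2 := \col_k [:: p.1; p.2]`_k.

Definition vec3 (p : R * R * R) : 'cV[R]_3 := join3 (vec2 p.1) p.2.

End vectors.

(* Lebesgue integration over R^2 and R^3 is carried out in coordinates. *)
Section integration.
Context {R : realType}.

Definition leb2 := (@lebesgue_measure R \x @lebesgue_measure R)%E.

Definition leb3 := (leb2 \x @lebesgue_measure R)%E.

(* \int_(R^2) \int_(R^3) g(xb, v) dv dxb *)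
Definition phint (g : 'cV[R]_2 -> 'cV[R]_3 -> R) : R :=
  \int[leb2]_p \int[leb3]_q g (vec2 p) (vec3 q).

Definition phintegrable (g : 'cV[R]_2 -> 'cV[R]_3 -> R) : Prop :=
  (leb2 \x leb3)%E.-integrable setT
    (fun p : (R * R) * (R * R * R) => (g (vec2 p.1) (vec3 p.2))%:E).

Definition phintegrable2
    (g : 'cV[R]_2 -> 'cV[R]_3 -> 'cV[R]_2 -> 'cV[R]_3 -> R) : Prop :=
  ((leb2 \x leb3) \x (leb2 \x leb3))%E.-integrable setT
    (fun p : ((R * R) * (R * R * R)) * ((R * R) * (R * R * R)) =>
      (g (vec2 p.1.1) (vec3 p.1.2) (vec2 p.2.1) (vec3 p.2.2))%:E).

End integration.

(* Differential calculus for functions of (x, v); the index k : 'I_(3 + 3)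
   runs over the coordinates x_1, x_2, x_3, v_1, v_2, v_3. *)
Section calculus.
Context {R : realType}.
Implicit Type u : 'cV[R]_3 -> 'cV[R]_3 -> R.

Definition pderivable (k : 'I_(3 + 3)) u (x v : 'cV[R]_3) : Prop :=
  match fintype.split k with
  | inl j => derivable (fun y => u y v) x (delta_mx j 0)
  | inr j => derivable (u x) v (delta_mx j 0)
  end.

Definition pderiv (k : 'I_(3 + 3)) u (x v : 'cV[R]_3) : R :=
  match fintype.split k with
  | inl j => 'D_(delta_mx j 0) (fun y => u y v) x
  | inr j => 'D_(delta_mx j 0) (u x) v
  end.

Definition smooth u : Prop := forall s : seq 'I_(3 + 3),
  continuous (fun p : 'cV[R]_3 * 'cV[R]_3 => foldr pderiv u s p.1 p.2) /\
  (forall k x v, pderivable k (foldr pderiv u s) x v).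

Context (omegac : R).

Definition sderiv (k : 'I_(3 + 3)) u (x v : 'cV[R]_3) : R :=
  (if (k < 3)%N then omegac^-1 else 1) * pderiv k u x v.

(* the scaled gradient (1/omegac grad_x u, grad_v u) *)
Definition grad u (x v : 'cV[R]_3) : 'cV[R]_(3 + 3) :=
  \col_k sderiv k u x v.

(* the scaled divergence 1/omegac div_x F_x + div_v F_v *)
Definition div6 (F : 'cV[R]_3 -> 'cV[R]_3 -> 'cV[R]_(3 + 3))
    (x v : 'cV[R]_3) : R :=
  \sum_k sderiv k (fun y w => F y w k 0) x v.

End calculus.

Section fields.
Context {R : realType}.

Definition chi (r r' : R) (z : 'cV[R]_2) : R :=
  if (`|r - r'| < enorm z) && (enorm z < r + r') then
    (pi ^+ 2 * Num.sqrt (enorm z ^+ 2 - (r - r') ^+ 2)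
             * Num.sqrt ((r + r') ^+ 2 - enorm z ^+ 2))^-1
  else 0.

(* See [angleP] below. *)
Definition angle (r r' : R) (z : 'cV[R]_2) : R :=
  acos ((r ^+ 2 + r' ^+ 2 - enorm z ^+ 2) / (2 * r * r')).

Context (omegac : R) (sigma : R -> R).

(* [xi i xb v xb' v'] for i = 0, 1, 2, 3 is the field written xi^1, ..., xi^4
   in the mathematical notation; similarly for [eps]. Since a = 0 when chi = 0,
   all four fields vanish there, in particular when bar v = 0. *)
Definition xi (i : 'I_4) (xb : 'cV[R]_2) (v : 'cV[R]_3)
    (xb' : 'cV[R]_2) (v' : 'cV[R]_3) : 'cV[R]_(3 + 3) :=
  let r := enorm (bar v) in
  let r' := enorm (bar v') in
  let z := omegac *: xb + perp (bar v) - (omegac *: xb' + perp (bar v')) in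
  let nz := enorm z in
  let d := third v - third v' in
  let n3 := Num.sqrt (nz ^+ 2 + d ^+ 2) in
  let a := Num.sqrt (sigma n3 * chi r r' z) in
  let phi := angle r r' z in
  let e := r^-1 *: hor (bar v) in
  let g := r^-1 *: hor (perp (bar v)) in
  match nat_of_ord i with
  | 0 => (a * (r' * sin phi * d / (nz * n3))) *: pair6 e g
  | 1 => a *: (((r - r' * cos phi) / nz) *: pair6 e g
               + pair6 (nz^-1 *: hor (perp z)) 0)
  | 2 => (a * (r' * sin phi / nz)) *: pair6 g (- e)
  | _ => a *: (((r' * cos phi - r) * d / (nz * n3)) *: pair6 g (- e)
               + n3^-1 *: pair6 (d *: (nz^-1 *: hor z)) (- (nz *: e3)))
  end.

Definition eps (i : 'I_4) : R := if (i < 2)%N then -1 else 1.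

End fields.

Lemma angleP (R : realType) (r r' : R) (z : 'cV[R]_2) :
  `|r - r'| < enorm z -> enorm z < r + r' ->
  0 < angle r r' z < pi /\
  enorm z ^+ 2 = r ^+ 2 + r' ^+ 2 - 2 * r * r' * cos (angle r r' z).
Proof.
move=> h1 h2; set n := enorm z in h1 h2 *.
have r_gt0 : 0 < r by move: h1; rewrite ltr_norml => /andP[]; lra.
have r'_gt0 : 0 < r' by move: h1; rewrite ltr_norml => /andP[]; lra.
have n_gt0 : 0 < n by apply: le_lt_trans h1.
have d_gt0 : 0 < 2 * r * r' by rewrite !mulr_gt0.
have sq : (r - r') ^+ 2 < n ^+ 2 by rewrite -(real_normK (num_real (r - r'))) ltr_pXn2r // ?nnegrE ?normr_ge0 // ltW.
have sq' : n ^+ 2 < (r + r') ^+ 2 by rewrite ltr_pXn2r // ?nnegrE ltW // addr_gt0.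
set c := (r ^+ 2 + r' ^+ 2 - n ^+ 2) / (2 * r * r').
have c1 : c < 1 by rewrite /c ltr_pdivrMr //; lra.
have cN1 : -1 < c by rewrite /c ltr_pdivlMr //; lra.
rewrite /angle -/n -/c; split.
  by rewrite acos_gt0 ?acos_ltpi ?cN1 ?c1 ?(ltW cN1) ?(ltW c1).
rewrite acosK; last by rewrite in_itv /= !ltW.
rewrite [_ * c]mulrC /c divfK ?lt0r_neq0 //; lra.
Qed.

Section operator.
Context {R : realType}.
Context (omegac : R) (sigma : R -> R).
Implicit Types (f psi : 'cV[R]_3 -> 'cV[R]_3 -> R).

Local Notation xi := (xi omegac sigma).
Local Notation grad := (grad omegac).

Definition diff_integrand f (x v : 'cV[R]_3) (xb' : 'cV[R]_2) (v' : 'cV[R]_3)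
    : 'cV[R]_(3 + 3) :=
  \sum_(i < 4) (f (join3 xb' (third x)) v' *:
    (tens (xi i (bar x) v xb' v') (xi i (bar x) v xb' v') *m grad f x v)).

Definition fric_integrand f (x v : 'cV[R]_3) (xb' : 'cV[R]_2) (v' : 'cV[R]_3)
    : 'cV[R]_(3 + 3) :=
  \sum_(i < 4) (f x v *:
    (tens (xi i (bar x) v xb' v') (eps i *: xi i xb' v' (bar x) v)
       *m grad f (join3 xb' (third x)) v')).

Definition diff_flux f (x v : 'cV[R]_3) : 'cV[R]_(3 + 3) :=
  \col_k phint (fun xb' v' => diff_integrand f x v xb' v' k 0).

Definition fric_flux f (x v : 'cV[R]_3) : 'cV[R]_(3 + 3) :=
  \col_k phint (fun xb' v' => fric_integrand f x v xb' v' k 0).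

Definition avgQ f (x v : 'cV[R]_3) : R :=
  omegac ^+ 2 *
  (div6 omegac (diff_flux f) x v - div6 omegac (fric_flux f) x v).

(* xi^i . grad u - eps_i (xi^i)' . grad' u' *)
Definition xi_jump (i : 'I_4) (x3 : R) (u : 'cV[R]_3 -> 'cV[R]_3 -> R)
    (xb : 'cV[R]_2) (v : 'cV[R]_3) (xb' : 'cV[R]_2) (v' : 'cV[R]_3) : R :=
  dot (xi i xb v xb' v') (grad u (join3 xb x3) v)
  - eps i * dot (xi i xb' v' xb v) (grad u (join3 xb' x3) v').

Definition lnf f (x v : 'cV[R]_3) : R := ln (f x v).

(* The unit vectors along bar v are only defined for bar v <> 0, and every
   field is set to 0 when bar v = 0; differentiability of a flux across this
   null set is therefore not to be expected. *)
Definition C1_flux (F : 'cV[R]_3 -> 'cV[R]_3 -> 'cV[R]_(3 + 3)) : Prop :=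
  forall k (x v : 'cV[R]_3), bar v != 0 ->
    pderivable k (fun y w => F y w k 0) x v /\
    {for (x, v), continuous (fun p : 'cV[R]_3 * 'cV[R]_3 =>
                   pderiv k (fun y w => F y w k 0) p.1 p.2)}.

(* Standing regularity of f: positivity, smoothness, and enough decay for the
   operator to be defined (convergence of the inner integrals, existence of the
   divergences). *)
Record regular f : Prop := Regular {
  regular_pos : forall x v, 0 < f x v ;
  regular_smooth : smooth f ;
  regular_diff_integrable : forall x v k,
    phintegrable (fun xb' v' => diff_integrand f x v xb' v' k 0) ;
  regular_fric_integrable : forall x v k,
    phintegrable (fun xb' v' => fric_integrand f x v xb' v' k 0) ;
  regular_diff_C1 : C1_flux (diff_flux f) ;
  regular_fric_C1 : C1_flux (fric_flux f)
}.

(* Decay of the flux F tested against psi at height x3: the two sides of the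
   integration by parts converge, and so does F psi (no mass at infinity). *)
Record flux_decay (x3 : R) (F : 'cV[R]_3 -> 'cV[R]_3 -> 'cV[R]_(3 + 3)) psi
    : Prop := FluxDecay {
  flux_decay_div : forall k, phintegrable (fun xb v =>
    pderiv k (fun y w => F y w k 0) (join3 xb x3) v * psi (join3 xb x3) v) ;
  flux_decay_grad : forall k, phintegrable (fun xb v =>
    F (join3 xb x3) v k 0 * pderiv k psi (join3 xb x3) v) ;
  flux_decay_prod : forall k, phintegrable (fun xb v =>
    F (join3 xb x3) v k 0 * psi (join3 xb x3) v)
}.

(* Decay of f tested against psi at height x3. The last field is the
   convergence of the multiple integrals of the weak formulation, before its
   symmetrization in (x, v) <-> (x', v'). *)
Record decay (x3 : R) f psi : Prop := Decay {
  decay_diff : flux_decay x3 (diff_flux f) psi ;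
  decay_fric : flux_decay x3 (fric_flux f) psi ;
  decay_weak : forall i : 'I_4, phintegrable2 (fun xb v xb' v' =>
    f (join3 xb x3) v * f (join3 xb' x3) v'
    * xi_jump i x3 (lnf f) xb v xb' v'
    * dot (xi i xb v xb' v') (grad psi (join3 xb x3) v))
}.

End operator.

(* Main.v *)
From HB Require Import structures.
Require Import Defs.
From mathcomp Require Import all_boot all_order all_algebra.
From mathcomp Require Import all_classical all_reals all_analysis.
From mathcomp Require Import measurable_realfun ring.
Import Order.TTheory GRing.Theory Num.Theory.
Import numFieldNormedType.Exports.
Local Open Scope ring_scope.

Set Implicit Arguments.
Unset Strict Implicit.
Unset Printing Implicit Defensive.

(** Let xi = xi^i, xi' = xi^i with the two particles exchanged, and write J(u) for
    the jump xi . grad u - eps_i xi' . grad' u'.  Since grad f = f grad (ln f),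
    the diffusion and friction fluxes combine into a single flux, the integral of
    f f' xi J(ln f) over the second particle, summed over i.  Its x_3 component
    is zero, because no xi^i has one, so that testing its divergence against psi
    on the slice of fixed x_3 and integrating by parts in the five variables
    (x_1, x_2, v) gives minus the double integral of f f' J(ln f) (xi . grad psi).
    Exchanging the particles turns J(u) into - eps_i J(u), as eps_i squares to 1;
    averaging the double integral with its exchanged version replaces
    xi . grad psi by J(psi) / 2.  This is [weak_form].

    Every other assertion is read off from this identity.  For psi = ln f the
    integrand is f f' J(ln f) ^ 2, hence nonnegative.  For psi with gradient
    (0, p e_3 + b v), which covers 1, v_3 and |v|^2 / 2, the jump J(psi) vanishes
    pointwise ([xi_jump_invariant]): for i = 1, 2 the velocity part of xi is
    orthogonal to both e_3 and v, for i = 3 the two terms of the jump are equal by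
    the symmetry of the amplitude, and for i = 4 they cancel by the law of cosines
    which defines the angle phi.

    The analytic content is the integration by parts.  The fluxes need not be
    differentiable where bar v = 0, but almost every line parallel to a coordinate
    axis of the five-dimensional phase space avoids this set, so by Fubini it
    suffices to know that the derivative of a C^1 function on the line has zero
    integral when the function and its derivative are integrable
    ([Rintegral_derive_eq0]).  Only first derivatives of psi enter, which is why
    the argument is carried out for C^1 test functions: ln f is then a test
    function without any computation of its higher derivatives. *)

(** * Iterated integrals of real-valued functions *)

Section product_measure.
Local Open Scope classical_set_scope.
Context {d1 d2} {T1 : measurableType d1} {T2 : measurableType d2} {R : realType}.
Context (m1 : {sigma_finite_measure set T1 -> \bar R}).
Context (m2 : {sigma_finite_measure set T2 -> \bar R}).

(** The product measure under a name of its own, to carry the sigma-finiteness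
    that is required of each factor when products are iterated. *)
Definition prodm : set (T1 * T2) -> \bar R := (m1 \x m2)%E.

HB.instance Definition _ := Measure.on prodm.

Lemma prodm_sigma_finite : sigma_finite setT prodm.
Proof.
have /sigma_finiteP[F [TF ndF mF]] := sigma_finiteT m1.
have /sigma_finiteP[G [TG ndG mG]] := sigma_finiteT m2.
exists (fun n => F n `*` G n) => [|n].
  apply/esym; rewrite -subTset => -[x y] _.
  have [n _ Fx] : (\bigcup_n F n) x by rewrite -TF.
  have [k _ Gy] : (\bigcup_n G n) y by rewrite -TG.
  exists (maxn n k) => //; split => /=.
    exact: (subsetPset _ _ (ndF _ _ (leq_maxl n k))).
  exact: (subsetPset _ _ (ndG _ _ (leq_maxr n k))).
have [mFn Fn] := mF n; have [mGn Gn] := mG n; split; first exact: measurableX.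
by rewrite /prodm product_measure1E// lte_mul_pinfty// ge0_fin_numE.
Qed.

HB.instance Definition _ :=
  Measure_isSigmaFinite.Build _ _ _ prodm prodm_sigma_finite.

End product_measure.

Notation rintegrable m f := (integrable m [set: _]%classic (EFin \o f)).

Section rintegral.
Local Open Scope classical_set_scope.
Context {d} {T : measurableType d} {R : realType}.
Context (m : {measure set T -> \bar R}).
Implicit Types f g : T -> R.

Lemma rintegrable_measurable f : rintegrable m f -> measurable_fun setT f.
Proof. by move=> /integrableP[/measurable_EFinP]. Qed.

Lemma rintegrableD f g : rintegrable m f -> rintegrable m g ->
  rintegrable m (fun x => f x + g x).
Proof. by move=> fi gi; apply: eq_integrable (integrableD measurableT fi gi). Qed.

Lemma rintegrableB f g : rintegrable m f -> rintegrable m g ->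
  rintegrable m (fun x => f x - g x).
Proof. by move=> fi gi; apply: eq_integrable (integrableB measurableT fi gi). Qed.

Lemma rintegrableZ c f : rintegrable m f -> rintegrable m (fun x => c * f x).
Proof. by move=> fi; apply: eq_integrable (integrableZl measurableT c fi). Qed.

Lemma rintegrable0 : rintegrable m (fun=> 0).
Proof. exact: integrable0. Qed.

Lemma rintegrable_sum I (r : seq I) (F : I -> T -> R) :
  (forall i, rintegrable m (F i)) -> rintegrable m (fun x => \sum_(i <- r) F i x).
Proof.
move=> Fi; elim: r => [|i r ih].
  by under eq_fun do rewrite big_nil; exact: rintegrable0.
by under eq_fun do rewrite big_cons; exact: rintegrableD.
Qed.

Lemma Rintegral_sum I (r : seq I) (F : I -> T -> R) :
  (forall i, rintegrable m (F i)) ->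
  \int[m]_x (\sum_(i <- r) F i x) = \sum_(i <- r) \int[m]_x F i x.
Proof.
move=> Fi; elim: r => [|i r ih].
  by under eq_Rintegral do rewrite big_nil; rewrite big_nil /Rintegral integral0.
under eq_Rintegral do rewrite big_cons.
rewrite big_cons -ih RintegralD//; exact: rintegrable_sum.
Qed.

Lemma ae_eq_Rintegral f g : measurable_fun setT f -> measurable_fun setT g ->
  {ae m, forall x, f x = g x} -> \int[m]_x f x = \int[m]_x g x.
Proof.
move=> mf mg fg; congr fine; apply: ae_eq_integral => //.
- exact/measurable_EFinP.
- exact/measurable_EFinP.
- by apply: filterS fg => x fgx _; rewrite fgx.
Qed.

Lemma ae_eq_rintegrable f g : measurable_fun setT f -> rintegrable m g ->
  {ae m, forall x, f x = g x} -> rintegrable m f.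
Proof.
move=> mf gi fg; have /integrableP[mg goo] := gi.
apply/integrableP; split; first exact/measurable_EFinP.
rewrite (@ae_eq_integral _ _ _ m setT (abse \o (EFin \o g)))//.
- by apply: measurableT_comp => //; exact/measurable_EFinP.
- exact: measurableT_comp.
- by apply: filterS fg => x fgx _ /=; rewrite fgx.
Qed.

Lemma ae_Rintegral_eq0 f : measurable_fun setT f ->
  {ae m, forall x, f x = 0} -> \int[m]_x f x = 0.
Proof.
move=> mf f0; rewrite (@ae_eq_Rintegral f (cst 0))//.
by rewrite /Rintegral integral0.
Qed.

End rintegral.

Section fubini.
Local Open Scope classical_set_scope.
Context {d1 d2} {T1 : measurableType d1} {T2 : measurableType d2} {R : realType}.
Context (m1 : {sigma_finite_measure set T1 -> \bar R}).
Context (m2 : {sigma_finite_measure set T2 -> \bar R}).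
Implicit Types h g : T1 * T2 -> R.

(** The integral of a measurable function is by definition a difference of two
    integrals covered by Tonelli. *)
Lemma measurable_integral_snd (f : T1 * T2 -> \bar R) : measurable_fun setT f ->
  measurable_fun setT (fubini_F m2 f).
Proof.
move=> mf.
rewrite (_ : fubini_F m2 f = fubini_F m2 f^\+ \- fubini_F m2 f^\-)%E; last first.
  apply/funext => x; rewrite /fubini_F [LHS]integralE.
  under eq_integral do rewrite funepos_comp/=.
  by under [X in (_ - X = _)%E]eq_integral do rewrite funeneg_comp/=.
apply: emeasurable_funB.
  by apply: measurable_fun_fubini_tonelli_F => //; exact: measurable_funepos.
by apply: measurable_fun_fubini_tonelli_F => //; exact: measurable_funeneg.
Qed.

Lemma measurable_Rintegral_snd h : measurable_fun setT h ->
  measurable_fun setT (fun x => \int[m2]_y h (x, y)).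
Proof.
move=> /measurable_EFinP/measurable_integral_snd mh.
exact: (measurableT_comp (fine_measurable measurableT) mh).
Qed.

Context (h : T1 * T2 -> R).
Context (hi : rintegrable (prodm m1 m2) h).

Lemma ae_rintegrable1 : {ae m1, forall x, rintegrable m2 (fun y => h (x, y))}.
Proof. exact: ae_integrable1 hi. Qed.

Lemma ae_rintegrable2 : {ae m2, forall y, rintegrable m1 (fun x => h (x, y))}.
Proof. exact: ae_integrable2 hi. Qed.

Lemma rintegrable_Rintegral1 : rintegrable m1 (fun x => \int[m2]_y h (x, y)).
Proof.
have Fi := integrable_fubini_F hi.
have /integrableP[mF _] := Fi.
suff FE : {ae m1, forall x, (EFin \o (fun x => \int[m2]_y h (x, y))) x
    = fubini_F m2 (EFin \o h) x}.
  have mf := measurable_Rintegral_snd (rintegrable_measurable hi).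
  have /integrableP[_ Foo] := Fi.
  apply/integrableP; split; first exact/measurable_EFinP.
  rewrite (@ae_eq_integral _ _ _ m1 setT (abse \o fubini_F m2 (EFin \o h)))//.
  - by apply: measurableT_comp => //; exact/measurable_EFinP.
  - exact: measurableT_comp.
  - by apply: filterS FE => x FEx _; exact: (congr1 (@abse R) FEx).
apply: filterS ae_rintegrable1 => x hx.
by rewrite /= fineK//; exact: integrable_fin_num.
Qed.

(** The real-valued inner integral differs from the extended one only on the null
    set of the x for which the section is not integrable. *)
Lemma Rintegral_prodm1 :
  \int[m1]_x \int[m2]_y h (x, y) = \int[prodm m1 m2]_p h p.
Proof.
congr fine; rewrite -[RHS](integral12_prod_meas1 hi).
have /integrableP[mF _] := integrable_fubini_F hi.
apply: ae_eq_integral => //.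
  apply/measurable_EFinP.
  exact: measurable_Rintegral_snd (rintegrable_measurable hi).
apply: filterS ae_rintegrable1 => x hx _.
by rewrite /fubini_F fineK//; exact: integrable_fin_num.
Qed.

Lemma Rintegral_prodm_eq0_1 :
  {ae m1, forall x, \int[m2]_y h (x, y) = 0} -> \int[prodm m1 m2]_p h p = 0.
Proof.
move=> h0; rewrite -Rintegral_prodm1; apply: ae_Rintegral_eq0 => //.
exact: measurable_Rintegral_snd (rintegrable_measurable hi).
Qed.

Lemma Rintegral_prodm_eq0_2 :
  {ae m2, forall y, \int[m1]_x h (x, y) = 0} -> \int[prodm m1 m2]_p h p = 0.
Proof.
move=> h0; rewrite /Rintegral -[X in fine X](integral21_prod_meas1 hi).
have mG := measurable_fubini_G hi.
rewrite (@ae_eq_integral _ _ _ m2 setT (cst 0%E)) ?integral0//.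
apply: filterS2 ae_rintegrable2 h0 => y hy h0y _.
rewrite /fubini_G -[LHS]fineK; last exact: integrable_fin_num.
by congr EFin.
Qed.

End fubini.

Section slicing.
Local Open Scope classical_set_scope.
Context {d1 d2} {T1 : measurableType d1} {T2 : measurableType d2} {R : realType}.
Context (m1 : {sigma_finite_measure set T1 -> \bar R}).
Context (m2 : {sigma_finite_measure set T2 -> \bar R}).
Context (g h : T1 * T2 -> R).
Context (gi : rintegrable (prodm m1 m2) g).
Context (hi : rintegrable (prodm m1 m2) h).

(** The integrability of almost every section, of an auxiliary function g as well as
    of h itself, is made available to the argument on the sections: there g will be
    a primitive of h along lines. *)
Lemma slice1_eq0 (P : T1 -> Prop) : {ae m1, forall x, P x} ->
  (forall x, P x -> rintegrable m2 (fun y => g (x, y)) ->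
     rintegrable m2 (fun y => h (x, y)) -> \int[m2]_y h (x, y) = 0) ->
  \int[prodm m1 m2]_p h p = 0.
Proof.
move=> aeP gh0; apply: Rintegral_prodm_eq0_1 => //.
by apply: filterS3 aeP (ae_rintegrable1 gi) (ae_rintegrable1 hi) => x; exact: gh0.
Qed.

Lemma slice2_eq0 (P : T2 -> Prop) : {ae m2, forall y, P y} ->
  (forall y, P y -> rintegrable m1 (fun x => g (x, y)) ->
     rintegrable m1 (fun x => h (x, y)) -> \int[m1]_x h (x, y) = 0) ->
  \int[prodm m1 m2]_p h p = 0.
Proof.
move=> aeP gh0; apply: Rintegral_prodm_eq0_2 => //.
by apply: filterS3 aeP (ae_rintegrable2 gi) (ae_rintegrable2 hi) => x; exact: gh0.
Qed.

End slicing.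

Section swap.
Local Open Scope classical_set_scope.
Context {d1 d2} {T1 : measurableType d1} {T2 : measurableType d2} {R : realType}.
Context (m1 : {sigma_finite_measure set T1 -> \bar R}).
Context (m2 : {sigma_finite_measure set T2 -> \bar R}).

(** Tonelli in both orders transfers integrability, Fubini the value. *)
Lemma prodm_swap (h : T1 * T2 -> R) : rintegrable (prodm m1 m2) h ->
  rintegrable (prodm m2 m1) (fun p => h (p.2, p.1)) /\
  \int[prodm m2 m1]_p h (p.2, p.1) = \int[prodm m1 m2]_p h p.
Proof.
move=> hi; have mh : measurable_fun setT (EFin \o h) by case/integrableP: hi.
have si : rintegrable (prodm m2 m1) (fun p => h (p.2, p.1)).
  have ms : measurable_fun setT (EFin \o (fun p : T2 * T1 => h (p.2, p.1))).
    apply: (measurableT_comp mh).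
    by apply: measurable_fun_pair; [exact: measurable_snd|exact: measurable_fst].
  apply: ((@integrable12ltyP _ _ _ _ _ m2 m1 _ ms).2).
  exact: ((@integrable21ltyP _ _ _ _ _ m1 m2 _ mh).1 hi).
split => //; congr fine.
by rewrite -[LHS](integral12_prod_meas1 si) -[RHS](integral21_prod_meas1 hi).
Qed.

End swap.

(** * Derivatives of integrable functions on the line *)

Section line.
Local Open Scope classical_set_scope.
Context {R : realType}.
Local Notation leb := (@lebesgue_measure R).
Implicit Types u : R -> R.

(** Otherwise |u| would be at least e on a set of infinite measure. *)
Lemma rintegrable_small_value u (A : set R) (e : R) :
  measurable A -> leb A = +oo%E -> rintegrable leb u -> 0 < e ->
  exists2 t : R, A t & `|u t| < e.
Proof.
move=> mA Aoo ui e0; apply: contrapT => /forall2NP small.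
have eu (t : R) : A t -> e <= `|u t| by case: (small t) => // /negP; rewrite -leNgt.
have /integrableP[/measurable_EFinP mu] := ui; apply/negP; rewrite -leNgt.
have mnu : measurable_fun setT (fun x => (`|u x|%:E)).
  by apply/measurable_EFinP; exact: measurableT_comp.
apply: (@le_trans _ _ (\int[leb]_(x in A) `|u x|%:E)%E); last first.
  exact: ge0_subset_integral.
rewrite -(@gt0_muley _ e%:E) ?lte_fin// -Aoo -integral_cst//.
apply: ge0_le_integral => //.
- by move=> x _; rewrite lee_fin ltW.
- exact: measurable_funS mnu.
Qed.

(** Integrability alone does not make u tend to 0 at infinity, but it provides
    points a_n <= - n and b_n >= n with u (a_n) and u (b_n) of order 1 / n.  The
    integral of u' over [a_n, b_n] is u (b_n) - u (a_n), which tends to 0, and it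
    tends to the integral over the line by dominated convergence. *)
Lemma Rintegral_derive_eq0 u : (forall t : R, derivable u t 1) ->
  continuous (derive1 u) -> rintegrable leb u -> rintegrable leb (derive1 u) ->
  \int[leb]_t (derive1 u) t = 0.
Proof.
move=> du cu' ui u'i.
have cu : continuous u.
  by move=> t; apply/differentiable_continuous/derivable1_diffP/du.
have /choice[b bP] n : exists t : R, n%:R <= t /\ `|u t| < n.+1%:R^-1.
  have [//|||t] := @rintegrable_small_value u `[n%:R, +oo[ n.+1%:R^-1 _ _ ui.
  - by rewrite lebesgue_measure_itv/= ltry.
  - by rewrite invr_gt0.
  - by rewrite /= in_itv/= andbT; exists t.
have /choice[a aP] n : exists t : R, t <= - n%:R /\ `|u t| < n.+1%:R^-1.
  have [//|||t] := @rintegrable_small_value u `]-oo, - n%:R] n.+1%:R^-1 _ _ ui.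
  - by rewrite lebesgue_measure_itv/= ltNyr.
  - by rewrite invr_gt0.
  - by rewrite /= in_itv/=; exists t.
have ab n : a n <= b n.
  by rewrite (le_trans (aP n).1)// (le_trans _ (bP n).1)// lerNl
    (le_trans _ (ler0n _ n))// oppr_le0.
have lim0 (c : R^nat) : (forall n, `|u (c n)| < n.+1%:R^-1) ->
    u (c n) @[n --> \oo] --> (0 : R).
  move=> cP; apply: norm_cvg0; apply: (squeeze_cvgr _ (cvg_cst 0) (@cvg_harmonic R)).
  by near=> n; rewrite normr_ge0 ltW.
have uba0 : (u (b n) - u (a n))%:E @[n --> \oo] --> (0 : R)%:E.
  apply: cvg_EFin; first by near=> n.
  rewrite -[X in _ --> X](subr0 (0 : R)); apply: cvgB.
    by apply: lim0 => n; case: (bP n).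
  by apply: lim0 => n; case: (aP n).
pose f_ n : R -> \bar R := (EFin \o (derive1 u)) \_ `[a n, b n].
have /integrableP[mu' _] := u'i.
have intf n : (\int[leb]_x f_ n x = (u (b n) - u (a n))%:E)%E.
  rewrite /f_ -integral_mkcond; have [abn|] := ltP (a n) (b n).
    apply: (@continuous_FTC2 _ (derive1 u) u _ _ abn); last by [].
      exact: continuous_subspaceT.
    split; first by move=> t _; apply: du.
      exact/cvg_at_right_filter/cu.
    exact/cvg_at_left_filter/cu.
  move=> ban; have -> : a n = b n by apply/eqP; rewrite eq_le ab.
  by rewrite set_itv1 integral_set1 subrr.
have [|||||_ _] := @dominated_convergence _ _ _ leb setT measurableT f_
    (EFin \o (derive1 u)) (abse \o (EFin \o (derive1 u))).
- by move=> n; apply/(measurable_restrictT _ _).1 => //; exact: measurable_funTS.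
- exact: mu'.
- apply: aeW => x _; apply: cvg_near_cst.
  near=> n; rewrite /f_ patchE mem_set//=.
  have xn : `|x| <= n%:R by near: n; exact: nbhs_infty_ger.
  rewrite in_itv/=; move: xn; rewrite ler_norml => /andP[nx xn].
  by rewrite (le_trans (aP n).1)//= (le_trans xn (bP n).1).
- exact: integrable_abse.
- by apply: aeW => x n _; rewrite /f_ patchE; case: ifPn => _; rewrite ?lexx// abse0 abse_ge0.
under eq_fun do rewrite intf.
move=> /(cvg_unique (@ereal_hausdorff R) uba0)/(congr1 fine).
by move=> /esym.
Unshelve. all: by end_near. Qed.

End line.

(** * Integration over the phase space of one particle *)

Section phase_space.
Local Open Scope classical_set_scope.
Context {R : realType}.
Local Notation leb := (@lebesgue_measure R).
Local Notation L2 := (prodm leb leb).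
Local Notation L3 := (prodm L2 leb).
Local Notation L5 := (prodm L2 L3).
Implicit Types g h : 'cV[R]_2 -> 'cV[R]_3 -> R.

Definition coord5 g (p : (R * R) * (R * R * R)) : R := g (vec2 p.1) (vec3 p.2).

Lemma phintegrableE g : phintegrable g = rintegrable L5 (coord5 g).
Proof. by []. Qed.

Lemma phintE g : phintegrable g -> phint g = \int[L5]_p coord5 g p.
Proof. by move=> gi; rewrite -Rintegral_prodm1. Qed.

Lemma phintD g h : phintegrable g -> phintegrable h ->
  phintegrable (fun x v => g x v + h x v) /\
  phint (fun x v => g x v + h x v) = phint g + phint h.
Proof.
rewrite !phintegrableE => gi hi.
have ghi : phintegrable (fun x v => g x v + h x v) by exact: rintegrableD gi hi.
by split=> //; rewrite !phintE// -RintegralD.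
Qed.

Lemma phintB g h : phintegrable g -> phintegrable h ->
  phintegrable (fun x v => g x v - h x v) /\
  phint (fun x v => g x v - h x v) = phint g - phint h.
Proof.
rewrite !phintegrableE => gi hi.
have ghi : phintegrable (fun x v => g x v - h x v) by exact: rintegrableB gi hi.
by split=> //; rewrite !phintE// -RintegralB.
Qed.

Lemma phintZ c g : phintegrable g ->
  phintegrable (fun x v => c * g x v) /\
  phint (fun x v => c * g x v) = c * phint g.
Proof.
rewrite !phintegrableE => gi.
have ghi : phintegrable (fun x v => c * g x v) by exact: rintegrableZ gi.
by split=> //; rewrite !phintE// -RintegralZl.
Qed.

Lemma phint_sum I (r : seq I) (g : I -> 'cV[R]_2 -> 'cV[R]_3 -> R) :
  (forall i, phintegrable (g i)) ->
  phintegrable (fun x v => \sum_(i <- r) g i x v) /\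
  phint (fun x v => \sum_(i <- r) g i x v) = \sum_(i <- r) phint (g i).
Proof.
move=> gi; have si : phintegrable (fun x v => \sum_(i <- r) g i x v).
  exact: (@rintegrable_sum _ _ _ L5 _ r (fun i => coord5 (g i)) gi).
split=> //; rewrite phintE// [LHS](@Rintegral_sum _ _ _ L5 _ r (fun i => coord5 (g i)) gi).
by apply: eq_bigr => i _; rewrite phintE.
Qed.

Lemma eq_phint g h : (forall x v, g x v = h x v) -> phint g = phint h.
Proof. by move=> gh; congr phint; apply/funext => x; apply/funext. Qed.

Lemma phint0 : phint (fun _ _ => 0 : R) = 0.
Proof.
by rewrite /phint; under eq_Rintegral do rewrite /Rintegral integral0;
  rewrite /Rintegral integral0.
Qed.

Lemma phint_ge0 g : (forall x v, 0 <= g x v) -> 0 <= phint g.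
Proof. by move=> g0; do 2 apply: Rintegral_ge0 => ? _. Qed.

Lemma ae_neq0 : {ae leb, forall y : R, y != 0}.
Proof.
exists [set 0 : R]; split => //; first exact: lebesgue_measure_set1.
by move=> y /= /negP; rewrite negbK => /eqP.
Qed.

Lemma prodm_setX_null d (T : measurableType d)
    (m : {sigma_finite_measure set T -> \bar R}) :
  prodm m leb (setT `*` [set 0 : R]) = 0%E.
Proof.
transitivity (m setT * leb [set 0%R])%E; first exact: product_measure1E.
by rewrite lebesgue_measure_set1 mule0.
Qed.

Lemma ae_snd_neq0 : {ae L2, forall p, p.2 != 0}.
Proof.
exists (setT `*` [set 0 : R]); split.
- exact: measurableX.
- exact: prodm_setX_null.
- by move=> y /= /negP; rewrite negbK => /eqP.
Qed.

(** The singular set bar v = 0 of the fluxes lies in the hyperplane v_2 = 0. *)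
Lemma ae_fst_snd_neq0 : {ae L3, forall q, q.1.2 != 0}.
Proof.
exists ((setT `*` [set 0 : R]) `*` setT); split.
- by do 2 apply: measurableX => //.
- transitivity (L2 (setT `*` [set 0%R]) * leb setT)%E.
    by apply: product_measure1E => //; exact: measurableX.
  by rewrite prodm_setX_null mul0e.
- by move=> y /= /negP; rewrite negbK => /eqP.
Qed.

Definition C1_line (u u' : R -> R) : Prop :=
  (forall t : R, is_derive t (1 : R) u (u' t)) /\ continuous u'.

Lemma C1_line_Rintegral_eq0 u u' : C1_line u u' ->
  rintegrable leb u -> rintegrable leb u' -> \int[leb]_t u' t = 0.
Proof.
move=> [du]; have <- : derive1 u = u'.
  by apply/funext => t; rewrite derive1E; exact: derive_val.
have du' (t : R) : derivable u t 1 by exact: ex_derive.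
exact: Rintegral_derive_eq0 du'.
Qed.

Lemma vec2_line1 (t y : R) : vec2 (t, y) = vec2 (0, y) + t *: delta_mx 0 0.
Proof.
apply/colP => i; rewrite !mxE; case: i => [[|[|//]] ?] /=.
  by rewrite mulr1 add0r.
by rewrite mulr0 addr0.
Qed.

Lemma vec2_line2 (t x : R) : vec2 (x, t) = vec2 (x, 0) + t *: delta_mx 1 0.
Proof.
apply/colP => i; rewrite !mxE; case: i => [[|[|//]] ?] /=.
  by rewrite mulr0 addr0.
by rewrite mulr1 add0r.
Qed.

Lemma join3E (w : 'cV[R]_2) (t : R) :
  join3 w t = \col_k [:: w 0 0; w 1 0; t]`_k.
Proof.
apply/colP => i; rewrite !mxE; case: splitP => j jE.
  rewrite jE; case: j jE => [[|[|//]] ?] /= _; congr (w _ _); exact/val_inj.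
by rewrite jE ord1 mxE.
Qed.

Lemma vec3E (x y z : R) : vec3 (x, y, z) = \col_k [:: x; y; z]`_k.
Proof. by rewrite /vec3 join3E; apply/colP => i; rewrite !mxE. Qed.

Lemma barE (v : 'cV[R]_3) : bar v = \col_k [:: v 0 0; v 1 0]`_k.
Proof.
apply/colP => i; rewrite !mxE; case: i => [[|[|//]] ?] /=;
  by congr (v _ _); exact/val_inj.
Qed.

Lemma vec3_line1 (t y z : R) : vec3 (t, y, z) = vec3 (0, y, z) + t *: delta_mx 0 0.
Proof.
apply/colP => i; rewrite !vec3E !mxE; case: i => [[|[|[|//]]] ?] /=;
  by rewrite ?mulr1 ?mulr0 ?add0r ?addr0.
Qed.

Lemma vec3_line2 (t x z : R) : vec3 (x, t, z) = vec3 (x, 0, z) + t *: delta_mx 1 0.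
Proof.
apply/colP => i; rewrite !vec3E !mxE; case: i => [[|[|[|//]]] ?] /=;
  by rewrite ?mulr1 ?mulr0 ?add0r ?addr0.
Qed.

Lemma vec3_line3 (t x y : R) :
  vec3 (x, y, t) = vec3 (x, y, 0) + t *: delta_mx ord_max 0.
Proof.
apply/colP => i; rewrite !vec3E !mxE; case: i => [[|[|[|//]]] ?] /=;
  by rewrite ?mulr1 ?mulr0 ?add0r ?addr0.
Qed.

Lemma bar_vec3 (q : R * R * R) : bar (vec3 q) = vec2 q.1.
Proof. by case: q => [[x y] z]; rewrite barE vec3E /vec2; apply/colP => i; rewrite !mxE. Qed.

Lemma vec2_neq0 (p : R * R) : (vec2 p != 0) = (p.1 != 0) || (p.2 != 0).
Proof.
apply/idP/idP; last first.
  move=> h; apply/eqP => /colP p0; move: (p0 0) (p0 1) h.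
  by rewrite !mxE /= => -> ->; rewrite eqxx.
apply: contraNT; rewrite negb_or !negbK => /andP[/eqP p1 /eqP p2].
by apply/eqP/colP => i; rewrite !mxE p1 p2; case: i => [[|[|//]] ?].
Qed.

(** Lines parallel to an x-axis do not move bar v, hence avoid the singular set for
    almost every velocity. *)
Lemma phint_dx_eq0 (j : 'I_2) g h : phintegrable g -> phintegrable h ->
  (forall xb v, bar v != 0 -> C1_line (fun t => g (xb + t *: delta_mx j 0) v)
                                      (fun t => h (xb + t *: delta_mx j 0) v)) ->
  phint h = 0.
Proof.
move=> gi hi C1; rewrite (phintE hi).
apply: (@slice2_eq0 _ _ _ _ _ L2 L3 (coord5 g) (coord5 h) gi hi _ ae_fst_snd_neq0).
move=> q q0 gqi hqi.
have barq : bar (vec3 q) != 0 by rewrite bar_vec3 vec2_neq0 q0 orbT.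
have C1_curve (c : R -> 'cV[R]_2) xb : (forall t, c t = xb + t *: delta_mx j 0) ->
    C1_line (fun t => g (c t) (vec3 q)) (fun t => h (c t) (vec3 q)).
  by move=> /funext ->; exact: C1.
case: j C1 C1_curve => [[|[|//]] jlt] _ C1_curve.
- have jE : Ordinal jlt = 0 by exact/val_inj.
  apply: (@slice2_eq0 _ _ _ _ _ leb leb _ _ gqi hqi xpredT (aeW _ (fun=> isT))).
  move=> y _ gi1 hi1; apply: (C1_line_Rintegral_eq0 _ gi1 hi1).
  by apply: (C1_curve _ (vec2 (0, y))) => t; rewrite vec2_line1 jE.
- have jE : Ordinal jlt = 1 by exact/val_inj.
  apply: (@slice1_eq0 _ _ _ _ _ leb leb _ _ gqi hqi xpredT (aeW _ (fun=> isT))).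
  move=> x _ gi1 hi1; apply: (C1_line_Rintegral_eq0 _ gi1 hi1).
  by apply: (C1_curve _ (vec2 (x, 0))) => t; rewrite vec2_line2 jE.
Qed.

(** A line parallel to the v_1-axis avoids bar v = 0 as soon as v_2 is nonzero, and
    conversely; a line parallel to the v_3-axis does not move bar v. *)
Lemma phint_dv_eq0 (j : 'I_3) g h : phintegrable g -> phintegrable h ->
  (forall xb v, (forall t, bar (v + t *: delta_mx j 0) != 0) ->
     C1_line (fun t => g xb (v + t *: delta_mx j 0))
             (fun t => h xb (v + t *: delta_mx j 0))) ->
  phint h = 0.
Proof.
move=> gi hi C1; rewrite (phintE hi).
apply: (@slice1_eq0 _ _ _ _ _ L2 L3 (coord5 g) (coord5 h) gi hi xpredT
  (aeW _ (fun=> isT))).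
move=> p _ gpi hpi.
have C1_curve (c : R -> R * R * R) (v : R * R * R) :
    (forall t, (c t).1.1 != 0 \/ (c t).1.2 != 0) ->
    (forall t, vec3 (c t) = vec3 v + t *: delta_mx j 0) ->
    C1_line (fun t => g (vec2 p) (vec3 (c t))) (fun t => h (vec2 p) (vec3 (c t))).
  move=> c0 cE; have /funext cE' := cE.
  rewrite (_ : (fun t => g _ _) = fun t => g (vec2 p) (vec3 v + t *: delta_mx j 0));
    last by apply/funext => t; rewrite cE.
  rewrite (_ : (fun t => h _ _) = fun t => h (vec2 p) (vec3 v + t *: delta_mx j 0));
    last by apply/funext => t; rewrite cE.
  apply: C1 => t; rewrite -cE bar_vec3 vec2_neq0.
  by case: (c0 t) => ->; rewrite ?orbT.
case: j C1 C1_curve => [[|[|[|//]]] jlt] _ C1_curve.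
- have jE : Ordinal jlt = 0 by exact/val_inj.
  apply: (@slice2_eq0 _ _ _ _ _ L2 leb _ _ gpi hpi xpredT (aeW _ (fun=> isT))).
  move=> z _ gi2 hi2; apply: (@slice2_eq0 _ _ _ _ _ leb leb _ _ gi2 hi2 _ ae_neq0).
  move=> y y0 gi1 hi1; apply: (C1_line_Rintegral_eq0 _ gi1 hi1).
  apply: (C1_curve (fun t => (t, y, z)) (0, y, z)) => t /=; first by right.
  by rewrite vec3_line1 jE.
- have jE : Ordinal jlt = 1 by exact/val_inj.
  apply: (@slice2_eq0 _ _ _ _ _ L2 leb _ _ gpi hpi xpredT (aeW _ (fun=> isT))).
  move=> z _ gi2 hi2; apply: (@slice1_eq0 _ _ _ _ _ leb leb _ _ gi2 hi2 _ ae_neq0).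
  move=> x x0 gi1 hi1; apply: (C1_line_Rintegral_eq0 _ gi1 hi1).
  apply: (C1_curve (fun t => (x, t, z)) (x, 0, z)) => t /=; first by left.
  by rewrite vec3_line2 jE.
- have jE : Ordinal jlt = ord_max by exact/val_inj.
  apply: (@slice1_eq0 _ _ _ _ _ L2 leb _ _ gpi hpi _ ae_snd_neq0).
  move=> y y0 gi1 hi1; apply: (C1_line_Rintegral_eq0 _ gi1 hi1).
  apply: (C1_curve (fun t => (y, t)) (y, 0)) => t /=; first by right.
  by case: y {y0 gi1 hi1} => y1 y2; rewrite vec3_line3 jE.
Qed.

End phase_space.

(** * Integration by parts on a slice of fixed x_3 *)

Section integration_by_parts.
Local Open Scope classical_set_scope.
Context {R : realType}.
Implicit Types F psi : 'cV[R]_3 -> 'cV[R]_3 -> R.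

Definition C1_along (k : 'I_(3 + 3)) F (x v : 'cV[R]_3) : Prop :=
  pderivable k F x v /\
  {for (x, v), continuous (fun p : 'cV[R]_3 * 'cV[R]_3 => pderiv k F p.1 p.2)}.

(** Directional derivatives are derivatives of the restriction to a line; the two
    difference quotients are literally the same. *)
Lemma line_quotient n (phi : 'cV[R]_n -> R) (a e : 'cV[R]_n) (t : R) :
  (fun h : R => h^-1 *: (((fun s : R => phi (a + s *: e)) \o shift t) (h *: (1 : R))
      - phi (a + t *: e))) =
  (fun h : R => h^-1 *: ((phi \o shift (a + t *: e)) (h *: e) - phi (a + t *: e))).
Proof.
apply/funext => h /=; congr (_ *: (phi _ - _)).
by rewrite (mulr1 h : h *: (1 : R) = h) scalerDl addrCA.
Qed.

Lemma derivable_line n (phi : 'cV[R]_n -> R) (a e : 'cV[R]_n) (t : R) :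
  derivable (fun s : R => phi (a + s *: e)) t (1 : R) =
  derivable phi (a + t *: e) e.
Proof. by rewrite /derivable line_quotient. Qed.

Lemma derive_line n (phi : 'cV[R]_n -> R) (a e : 'cV[R]_n) (t : R) :
  'D_(1 : R) (fun s : R => phi (a + s *: e)) t = 'D_e phi (a + t *: e).
Proof. by rewrite /derive line_quotient. Qed.

Lemma is_derive_line n (phi : 'cV[R]_n -> R) (a e : 'cV[R]_n) (t : R) :
  derivable phi (a + t *: e) e ->
  is_derive t (1 : R) (fun s : R => phi (a + s *: e)) ('D_e phi (a + t *: e)).
Proof. by move=> dphi; apply: DeriveDef; rewrite ?derivable_line ?derive_line. Qed.

Lemma continuous_line n (a e : 'cV[R]_n) : continuous (fun t : R => a + t *: e).
Proof.
move=> t; apply: cvgD; first exact: cvg_cst.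
by apply: cvgZr_tmp; exact: cvg_id.
Qed.

Lemma C1_lineM (u u' w w' : R -> R) : C1_line u u' -> C1_line w w' ->
  C1_line (fun t => u t * w t) (fun t => u' t * w t + u t * w' t).
Proof.
move=> [du cu'] [dw cw'].
have cu (z z' : R -> R) : (forall t : R, is_derive t (1 : R) z (z' t)) -> continuous z.
  move=> dz t; apply/differentiable_continuous/derivable1_diffP.
  exact: (@ex_derive _ _ _ _ _ _ _ (dz t)).
split=> [t|t].
  rewrite (_ : u' t * w t + _ = u t *: w' t + w t *: u' t); last first.
    by rewrite /GRing.scale/= addrC [w t * _]mulrC.
  exact: is_deriveM (du t) (dw t).
apply: cvgD; apply: cvgM; [exact: cu'|exact: (cu _ _ dw)|exact: (cu _ _ du)|exact: cw'].
Qed.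

Lemma pderivx (j : 'I_3) F x v :
  pderiv (lshift 3 j) F x v = 'D_(delta_mx j 0) (fun y => F y v) x.
Proof. by rewrite /pderiv (unsplitK (inl j)). Qed.

Lemma pderivv (j : 'I_3) F x v :
  pderiv (rshift 3 j) F x v = 'D_(delta_mx j 0) (F x) v.
Proof. by rewrite /pderiv (unsplitK (inr j)). Qed.

Lemma pderivablex (j : 'I_3) F x v :
  pderivable (lshift 3 j) F x v = derivable (fun y => F y v) x (delta_mx j 0).
Proof. by rewrite /pderivable (unsplitK (inl j)). Qed.

Lemma pderivablev (j : 'I_3) F x v :
  pderivable (rshift 3 j) F x v = derivable (F x) v (delta_mx j 0).
Proof. by rewrite /pderivable (unsplitK (inr j)). Qed.

Lemma C1_linex (j : 'I_3) F x v :
  (forall t, C1_along (lshift 3 j) F (x + t *: delta_mx j 0) v) ->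
  C1_line (fun t => F (x + t *: delta_mx j 0) v)
          (fun t => pderiv (lshift 3 j) F (x + t *: delta_mx j 0) v).
Proof.
move=> C1; split=> t; have [dF cF] := C1 t.
  by rewrite pderivx; apply: (@is_derive_line _ (F^~ v)); rewrite -pderivablex.
by apply: continuous2_cvg; [exact: cF|exact: continuous_line|exact: cvg_cst].
Qed.

Lemma C1_linev (j : 'I_3) F x v :
  (forall t, C1_along (rshift 3 j) F x (v + t *: delta_mx j 0)) ->
  C1_line (fun t => F x (v + t *: delta_mx j 0))
          (fun t => pderiv (rshift 3 j) F x (v + t *: delta_mx j 0)).
Proof.
move=> C1; split=> t; have [dF cF] := C1 t.
  by rewrite pderivv; apply: is_derive_line; rewrite -pderivablev.
by apply: continuous2_cvg; [exact: cF|exact: cvg_cst|exact: continuous_line].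
Qed.

Lemma join3_line (xb : 'cV[R]_2) (j : 'I_2) (x3 t : R) :
  join3 (xb + t *: delta_mx j 0) x3 =
  join3 xb x3 + t *: delta_mx (lshift 1 j : 'I_(2 + 1)) 0.
Proof.
apply/colP => i; rewrite !mxE; case: splitP => k ik; rewrite !mxE ?andbT.
  by rewrite (_ : (i == _) = (k == j)) // -!val_eqE /= ik.
rewrite (_ : (i == _) = false) ?mulr0 ?addr0// -val_eqE /= ik gtn_eqF//.
exact: ltn_addr.
Qed.

(** F psi restricted to almost every line along the k-th axis is C^1 with
    integrable derivative, so the two terms of the product rule cancel after
    integration.  Only the continuity of the k-th derivative of F is at hand, which
    is why F psi is differentiated on lines and not as a function of all variables.
    The axis x_3 is excluded since x_3 is not integrated. *)
Lemma phint_by_parts (k : 'I_(3 + 3)) F psi (x3 : R) : k != 2%N :> nat ->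
  (forall x v, bar v != 0 -> C1_along k F x v) ->
  (forall x v, C1_along k psi x v) ->
  phintegrable (fun xb v => F (join3 xb x3) v * psi (join3 xb x3) v) ->
  phintegrable (fun xb v => pderiv k F (join3 xb x3) v * psi (join3 xb x3) v) ->
  phintegrable (fun xb v => F (join3 xb x3) v * pderiv k psi (join3 xb x3) v) ->
  phint (fun xb v => pderiv k F (join3 xb x3) v * psi (join3 xb x3) v) =
  - phint (fun xb v => F (join3 xb x3) v * pderiv k psi (join3 xb x3) v).
Proof.
move=> k2 C1F C1psi Fpsi dF dpsi; apply/eqP; rewrite -subr_eq0 opprK.
have [sumi <-] := phintD dF dpsi; apply/eqP.
case: (split_ordP k) k2 C1F C1psi dF dpsi sumi => j -> k2 C1F C1psi _ _ sumi.
  case: (@split_ordP 2 1 j) k2 C1F C1psi sumi => {}j -> k2 C1F C1psi sumi.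
    apply: (phint_dx_eq0 (j := j) Fpsi sumi) => xb v v0.
    under eq_fun do rewrite join3_line; under [X in C1_line _ X]eq_fun do rewrite join3_line.
    by apply: C1_lineM; apply: C1_linex => t; [exact: C1F|exact: C1psi].
  by move: k2; rewrite /= ord1.
apply: (phint_dv_eq0 (j := j) Fpsi sumi) => xb v v0.
by apply: C1_lineM; apply: C1_linev => t; [exact: C1F|exact: C1psi].
Qed.

End integration_by_parts.

(** * Integration over the phase space of two particles *)

Section two_particles.
Local Open Scope classical_set_scope.
Context {R : realType}.
Local Notation leb := (@lebesgue_measure R).
Local Notation L2 := (prodm leb leb).
Local Notation L3 := (prodm L2 leb).
Local Notation L5 := (prodm L2 L3).
Implicit Types h : 'cV[R]_2 -> 'cV[R]_3 -> 'cV[R]_2 -> 'cV[R]_3 -> R.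

Definition coord10 h (p : ((R * R) * (R * R * R)) * ((R * R) * (R * R * R))) : R :=
  h (vec2 p.1.1) (vec3 p.1.2) (vec2 p.2.1) (vec3 p.2.2).

(** Measurability of the inner integral has to be proved for the iterated integral
    itself, without recourse to the product measure, because the two may differ on
    a null set of parameters where the section is not integrable. *)
Lemma phint2P h : phintegrable2 h ->
  phintegrable (fun x v => phint (h x v)) /\
  phint (fun x v => phint (h x v)) = \int[prodm L5 L5]_p coord10 h p.
Proof.
move=> hi; have {}hi : rintegrable (prodm L5 L5) (coord10 h) := hi.
have mh := rintegrable_measurable hi.
have mph : measurable_fun setT (coord5 (fun x v => phint (h x v))).
  pose h' (q : (((R * R) * (R * R * R)) * (R * R)) * (R * R * R)) : R :=
    coord10 h (q.1.1, (q.1.2, q.2)).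
  have mh' : measurable_fun setT h'.
    apply: (measurableT_comp mh); apply: measurable_fun_pair.
      exact: measurableT_comp measurable_fst measurable_fst.
    apply: measurable_fun_pair; last exact: measurable_snd.
    exact: measurableT_comp measurable_snd measurable_fst.
  exact: (measurable_Rintegral_snd L2 (measurable_Rintegral_snd L3 mh')).
have aeE : {ae L5, forall p, coord5 (fun x v => phint (h x v)) p =
    \int[L5]_q coord10 h (p, q)}.
  by apply: filterS (ae_rintegrable1 hi) => p hp; exact: phintE.
have phi : phintegrable (fun x v => phint (h x v)).
  rewrite phintegrableE.
  apply: (@ae_eq_rintegrable _ _ _ L5 (coord5 (fun x v => phint (h x v)))
    (fun p => \int[L5]_q coord10 h (p, q)) mph _ aeE).
  exact: (@rintegrable_Rintegral1 _ _ _ _ _ L5 L5).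
split; first exact: phi.
rewrite (phintE phi) -[RHS](Rintegral_prodm1 hi).
apply: (@ae_eq_Rintegral _ _ _ L5 (coord5 (fun x v => phint (h x v)))
  (fun p => \int[L5]_q coord10 h (p, q)) mph _ aeE).
exact: (@measurable_Rintegral_snd _ _ _ _ _ L5 (coord10 h)).
Qed.

Lemma phint2_swap h : phintegrable2 h ->
  phintegrable2 (fun x v x' v' => h x' v' x v) /\
  phint (fun x v => phint (fun x' v' => h x' v' x v)) =
  phint (fun x v => phint (h x v)).
Proof.
move=> hi; have [si sE] := @prodm_swap _ _ _ _ _ L5 L5 (coord10 h) hi.
have si' : phintegrable2 (fun x v x' v' => h x' v' x v) := si.
split; first exact: si'.
exact: etrans (phint2P si').2 (etrans sE (esym (phint2P hi).2)).
Qed.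

Lemma phint2D h1 h2 : phintegrable2 h1 -> phintegrable2 h2 ->
  phintegrable2 (fun x v x' v' => h1 x v x' v' + h2 x v x' v') /\
  phint (fun x v => phint (fun x' v' => h1 x v x' v' + h2 x v x' v')) =
  phint (fun x v => phint (h1 x v)) + phint (fun x v => phint (h2 x v)).
Proof.
move=> i1 i2; have di : phintegrable2 (fun x v x' v' => h1 x v x' v' + h2 x v x' v').
  exact: (@rintegrableD _ _ _ (prodm L5 L5) (coord10 h1) (coord10 h2) i1 i2).
split; first exact: di.
apply: etrans (phint2P di).2 _.
apply: etrans (congr2 +%R (esym (phint2P i1).2) (esym (phint2P i2).2)).
exact: (@RintegralD _ _ _ (prodm L5 L5) setT (coord10 h1) (coord10 h2)).
Qed.

Lemma phint2_sum I (r : seq I) (h : I -> 'cV[R]_2 -> 'cV[R]_3 -> 'cV[R]_2 -> 'cV[R]_3 -> R) :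
  (forall i, phintegrable2 (h i)) ->
  phint (fun x v => phint (fun x' v' => \sum_(i <- r) h i x v x' v')) =
  \sum_(i <- r) phint (fun x v => phint (h i x v)).
Proof.
move=> hi; have si : phintegrable2 (fun x v x' v' => \sum_(i <- r) h i x v x' v').
  exact: (@rintegrable_sum _ _ _ (prodm L5 L5) _ r (fun i => coord10 (h i)) hi).
apply: etrans (phint2P si).2 _.
apply: etrans (@Rintegral_sum _ _ _ (prodm L5 L5) _ r (fun i => coord10 (h i)) hi) _.
by apply: eq_bigr => i _; exact: esym (phint2P (hi i)).2.
Qed.

End two_particles.

(** * First-order test functions and the gradient of ln f *)

Section log_gradient.
Local Open Scope classical_set_scope.
Context {R : realType}.
Implicit Types f psi : 'cV[R]_3 -> 'cV[R]_3 -> R.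

Definition C1 psi : Prop := forall k x v, C1_along k psi x v.

Lemma smooth_C1 psi : smooth psi -> C1 psi.
Proof.
by move=> s k x v; split; [have [_] := s [::]; exact|have [+ _] := s [:: k]; exact].
Qed.

Lemma smooth_continuous f : smooth f ->
  continuous (fun p : 'cV[R]_3 * 'cV[R]_3 => f p.1 p.2).
Proof. by move=> s; have [] := s [::]. Qed.

Lemma derive_ln n (phi : 'cV[R]_n -> R) (a e : 'cV[R]_n) :
  derivable phi a e -> 0 < phi a ->
  derivable (fun y => ln (phi y)) a e /\
  'D_e (fun y => ln (phi y)) a = (phi a)^-1 * 'D_e phi a.
Proof.
have aE : a = a + (0 : R) *: e by rewrite scale0r addr0.
rewrite aE => dphi phi0.
have := @is_derive1_comp _ (@ln R) (fun s : R => phi (a + s *: e)) 0 _ _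
  (is_derive1_ln phi0) (is_derive_line dphi).
move=> [dln vln]; split; first by rewrite -(derivable_line (fun y => ln (phi y))).
by rewrite -(derive_line (fun y => ln (phi y))).
Qed.

Lemma pderiv_lnf f k x v : 0 < f x v -> pderivable k f x v ->
  pderivable k (lnf f) x v /\
  pderiv k (lnf f) x v = (f x v)^-1 * pderiv k f x v.
Proof.
move=> f0; case: (split_ordP k) => j ->.
  by rewrite !pderivablex !pderivx => df; exact: (@derive_ln _ (f^~ v)).
by rewrite !pderivablev !pderivv => df; exact: derive_ln.
Qed.

Lemma C1_lnf f : (forall x v, 0 < f x v) -> smooth f -> C1 (lnf f).
Proof.
move=> f0 fs k x v; have C1f := smooth_C1 fs.
have lnE y w := pderiv_lnf (f0 y w) (C1f k y w).1.
split; first exact: (lnE x v).1.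
rewrite (_ : (fun p => _) = (fun p : 'cV[R]_3 * 'cV[R]_3 =>
    (f p.1 p.2)^-1 * pderiv k f p.1 p.2)); last first.
  by apply/funext => p; exact: (lnE p.1 p.2).2.
apply: cvgM; last exact: (C1f k x v).2.
by apply: cvgV; [rewrite gt_eqF|exact: smooth_continuous].
Qed.

Context (omegac : R).

(** This identity turns f' (xi . grad f) and f (xi' . grad' f') into multiples of
    the same density f f'. *)
Lemma grad_lnf f x v : 0 < f x v -> (forall k, pderivable k f x v) ->
  f x v *: grad omegac (lnf f) x v = grad omegac f x v.
Proof.
move=> f0 df; apply/colP => k; rewrite !mxE /sderiv (pderiv_lnf f0 (df k)).2.
by rewrite mulrCA mulVKf ?gt_eqF.
Qed.

End log_gradient.

(** * The weak form of the collision operator *)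

Section divergence.
Context {R : realType}.
Context (omegac x3 : R).
Implicit Types F : 'cV[R]_3 -> 'cV[R]_3 -> 'cV[R]_(3 + 3).
Implicit Types psi : 'cV[R]_3 -> 'cV[R]_3 -> R.

Definition x3_index : 'I_(3 + 3) := lshift 3 (ord_max : 'I_3).

Lemma pderiv0 k (x v : 'cV[R]_3) : pderiv k (fun _ _ => 0 : R) x v = 0.
Proof. by case: (split_ordP k) => j ->; rewrite ?pderivx ?pderivv derive_cst. Qed.

(** The hypothesis on the x_3 component replaces the integration by parts along
    the only axis that is not integrated. *)
Lemma phint_div6 F psi : (forall x v, F x v x3_index 0 = 0) ->
  C1_flux F -> C1 psi -> flux_decay x3 F psi ->
  [/\ phintegrable (fun xb v =>
        div6 omegac F (join3 xb x3) v * psi (join3 xb x3) v),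
      phintegrable (fun xb v =>
        dot (F (join3 xb x3) v) (grad omegac psi (join3 xb x3) v)) &
      phint (fun xb v => div6 omegac F (join3 xb x3) v * psi (join3 xb x3) v) =
    - phint (fun xb v => dot (F (join3 xb x3) v) (grad omegac psi (join3 xb x3) v))].
Proof.
move=> F0 C1F C1psi [divi gradi prodi].
pose c (k : 'I_(3 + 3)) : R := if (k < 3)%N then omegac^-1 else 1.
have divE : (fun xb v => div6 omegac F (join3 xb x3) v * psi (join3 xb x3) v) =
    (fun xb v => \sum_k c k *
      (pderiv k (fun y w => F y w k 0) (join3 xb x3) v * psi (join3 xb x3) v)).
  apply/funext => xb; apply/funext => v; rewrite /div6 mulr_suml.
  by apply: eq_bigr => k _; rewrite /sderiv -mulrA.
have gradE : (fun xb v => dot (F (join3 xb x3) v) (grad omegac psi (join3 xb x3) v)) =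
    (fun xb v => \sum_k c k *
      (F (join3 xb x3) v k 0 * pderiv k psi (join3 xb x3) v)).
  apply/funext => xb; apply/funext => v; rewrite /dot.
  by apply: eq_bigr => k _; rewrite mxE /sderiv mulrCA.
have parts k : phint (fun xb v =>
      pderiv k (fun y w => F y w k 0) (join3 xb x3) v * psi (join3 xb x3) v) =
    - phint (fun xb v => F (join3 xb x3) v k 0 * pderiv k psi (join3 xb x3) v).
  have [k2|k2] := eqVneq (k : nat) 2%N; last first.
    apply: (@phint_by_parts _ k (fun y w => F y w k 0)) => //.
    by move=> x v; exact: C1F.
  have -> : k = x3_index by exact/val_inj.
  have F0E : (fun y w => F y w x3_index 0) = (fun _ _ => 0).
    by apply/funext => y; apply/funext => w; exact: F0.
  rewrite F0E.
  rewrite (@eq_phint _ _ (fun _ _ => 0)) => [|xb v]; last by rewrite pderiv0 mul0r.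
  rewrite [X in _ = - X](@eq_phint _ _ (fun _ _ => 0)) => [|xb v].
    by rewrite phint0 oppr0.
  by rewrite F0 mul0r.
rewrite divE gradE.
have [di dE] := phint_sum (index_enum _) (fun k => (phintZ (c k) (divi k)).1).
have [gi gE] := phint_sum (index_enum _) (fun k => (phintZ (c k) (gradi k)).1).
split; [exact: di|exact: gi|].
rewrite dE gE -sumrN; apply: eq_bigr => k _.
by rewrite (phintZ (c k) (divi k)).2 (phintZ (c k) (gradi k)).2 parts mulrN.
Qed.

End divergence.

Section weak_form.
Context {R : realType}.
Context (omegac : R) (sigma : R -> R).
Implicit Types f psi : 'cV[R]_3 -> 'cV[R]_3 -> R.

Local Notation xi := (xi omegac sigma).
Local Notation grad := (grad omegac).

Lemma bar_join3 (w : 'cV[R]_2) (t : R) : bar (join3 w t) = w.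
Proof. exact: col_mxKu. Qed.

Lemma third_join3 (w : 'cV[R]_2) (t : R) : third (join3 w t) = t.
Proof. by rewrite /third join3E mxE. Qed.

Lemma tens_mul n (a b c : 'cV[R]_n) k : (tens a b *m c) k 0 = a k 0 * dot b c.
Proof.
rewrite /tens -mulmxA !mxE big_ord1; congr (_ * _).
by rewrite !mxE; apply: eq_bigr => j _; rewrite mxE.
Qed.

Lemma dotBl n (a b c : 'cV[R]_n) : dot (a - b) c = dot a c - dot b c.
Proof.
by rewrite /dot -sumrB; apply: eq_bigr => k _; rewrite !mxE mulrBl.
Qed.

Lemma dotC n (a b : 'cV[R]_n) : dot a b = dot b a.
Proof. by apply: eq_bigr => k _; rewrite mulrC. Qed.

Lemma dotZl n c (a b : 'cV[R]_n) : dot (c *: a) b = c * dot a b.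
Proof. by rewrite /dot mulr_sumr; apply: eq_bigr => k _; rewrite mxE mulrA. Qed.

Lemma dotZr n c (a b : 'cV[R]_n) : dot a (c *: b) = c * dot a b.
Proof. by rewrite dotC dotZl dotC. Qed.

Lemma pair6_x3 (a b : 'cV[R]_3) : pair6 a b x3_index 0 = third a.
Proof. by rewrite /pair6 /x3_index col_mxEu. Qed.

(** The vertical part of each field lies in its velocity half. *)
Lemma xi_x3 (i : 'I_4) xb v xb' v' : xi i xb v xb' v' x3_index 0 = 0.
Proof.
have hor3 (w : 'cV[R]_2) : third (hor w) = 0 by exact: third_join3.
have thirdZ c (a : 'cV[R]_3) : third (c *: a) = c * third a by rewrite /third mxE.
have ZE c (a : 'cV[R]_(3 + 3)) : (c *: a) x3_index 0 = c * a x3_index 0 by rewrite mxE.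
have DE (a b : 'cV[R]_(3 + 3)) : (a + b) x3_index 0 = a x3_index 0 + b x3_index 0.
  by rewrite mxE.
by rewrite /xi; case: i => [[|[|[|[|//]]]] ?] /=;
  rewrite ?(ZE, DE) ?pair6_x3 ?thirdZ ?hor3 ?mulr0 ?addr0 ?mulr0.
Qed.

Lemma diff_integrandE f x v xb' v' k :
  diff_integrand omegac sigma f x v xb' v' k 0 =
  \sum_(i < 4) f (join3 xb' (third x)) v' *
    (xi i (bar x) v xb' v' k 0 * dot (xi i (bar x) v xb' v') (grad f x v)).
Proof. by rewrite summxE; apply: eq_bigr => i _; rewrite mxE tens_mul. Qed.

Lemma fric_integrandE f x v xb' v' k :
  fric_integrand omegac sigma f x v xb' v' k 0 =
  \sum_(i < 4) f x v * (xi i (bar x) v xb' v' k 0 *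
    (eps i * dot (xi i xb' v' (bar x) v) (grad f (join3 xb' (third x)) v'))).
Proof. by rewrite summxE; apply: eq_bigr => i _; rewrite mxE tens_mul dotZl. Qed.

Lemma diff_flux_x3 f x v : diff_flux omegac sigma f x v x3_index 0 = 0.
Proof.
rewrite mxE (@eq_phint _ _ (fun _ _ => 0)) ?phint0// => xb' v'.
by rewrite diff_integrandE big1// => i _; rewrite xi_x3 mul0r mulr0.
Qed.

Lemma fric_flux_x3 f x v : fric_flux omegac sigma f x v x3_index 0 = 0.
Proof.
rewrite mxE (@eq_phint _ _ (fun _ _ => 0)) ?phint0// => xb' v'.
by rewrite fric_integrandE big1// => i _; rewrite xi_x3 mul0r mulr0.
Qed.

Lemma dot_grad_lnf f a x v : 0 < f x v -> (forall k, pderivable k f x v) ->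
  dot a (grad f x v) = f x v * dot a (grad (lnf f) x v).
Proof. by move=> f0 df; rewrite -dotZr grad_lnf. Qed.

(** What the collision term tested against psi becomes once the divergences have
    been moved onto psi; the last factor is not yet a jump, so that the integrand is
    not symmetric under the exchange of the particles. *)
Definition weak_integrand (i : 'I_4) (x3 : R) f psi xb v xb' v' : R :=
  f (join3 xb x3) v * f (join3 xb' x3) v'
  * xi_jump omegac sigma i x3 (lnf f) xb v xb' v'
  * dot (xi i xb v xb' v') (grad psi (join3 xb x3) v).

(** Both fluxes contain the factor xi^i tested against g; the remaining factors
    f' (xi . grad f) and eps f (xi' . grad' f') combine into f f' times the jump of
    ln f. *)
Lemma flux_dot f (x3 : R) (g : 'cV[R]_(3 + 3)) xb v :
  regular omegac sigma f ->
  dot (diff_flux omegac sigma f (join3 xb x3) v) g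
  - dot (fric_flux omegac sigma f (join3 xb x3) v) g =
  phint (fun xb' v' => \sum_(i < 4) f (join3 xb x3) v * f (join3 xb' x3) v'
    * xi_jump omegac sigma i x3 (lnf f) xb v xb' v' * dot (xi i xb v xb' v') g).
Proof.
move=> fr; set x := join3 xb x3.
have f0 := regular_pos fr.
have df y w k : pderivable k f y w by exact: (smooth_C1 (regular_smooth fr) k y w).1.
(* the algebra, with the fields and the gradients as atoms *)
have alg (a b c d e A B A' B' : R) : A' = a * A -> B' = b * B ->
    (b * (c * A') - a * (c * (e * B'))) * d = a * b * (A - e * B) * (c * d).
  by move=> -> ->; ring.
have dotE (F : 'cV[R]_2 -> 'cV[R]_3 -> 'cV[R]_(3 + 3)) :
    (forall k, phintegrable (fun xb' v' => F xb' v' k 0)) ->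
    phintegrable (fun xb' v' => dot (F xb' v') g) /\
    dot (\col_k phint (fun xb' v' => F xb' v' k 0)) g =
    phint (fun xb' v' => dot (F xb' v') g).
  move=> Fi; have gE : (fun xb' v' => dot (F xb' v') g) =
      (fun xb' v' => \sum_k g k 0 * F xb' v' k 0).
    apply/funext => xb'; apply/funext => v'.
    by apply: eq_bigr => k _; rewrite mulrC.
  have [si sE] := phint_sum (index_enum _) (fun k => (phintZ (g k 0) (Fi k)).1).
  rewrite gE; split; first exact: si.
  rewrite sE; apply: eq_bigr => k _.
  by rewrite mxE mulrC (phintZ (g k 0) (Fi k)).2.
have [Di DE] := dotE _ (regular_diff_integrable fr x v).
have [Fi FE] := dotE _ (regular_fric_integrable fr x v).
apply: etrans (congr2 (fun a b => a - b) DE FE) _.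
apply: etrans (esym (phintB Di Fi).2) _; apply: eq_phint => xb' v'.
rewrite -dotBl /dot (eq_bigr (fun k => \sum_(i < 4)
   (f x v * f (join3 xb' x3) v' * xi_jump omegac sigma i x3 (lnf f) xb v xb' v') *
   (xi i xb v xb' v' k 0 * g k 0))); last first.
  move=> k _; have subE (a b : 'cV[R]_(3 + 3)) : (a - b) k 0 = a k 0 - b k 0.
    by rewrite !mxE.
  rewrite subE diff_integrandE fric_integrandE -sumrB mulr_suml.
  apply: eq_bigr => i _; rewrite /x third_join3 bar_join3 -/x.
  exact: alg (dot_grad_lnf _ (f0 x v) (df x v)) (dot_grad_lnf _ (f0 _ v') (df _ v')).
rewrite exchange_big/=; apply: eq_bigr => i _.
by rewrite -mulr_sumr.
Qed.

End weak_form.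

Section symmetrization.
Context {R : realType}.
Context (omegac : R) (sigma : R -> R).
Implicit Types f psi : 'cV[R]_3 -> 'cV[R]_3 -> R.

Lemma epsM (i : 'I_4) : eps i * eps i = 1 :> R.
Proof. by rewrite /eps; case: ifP => _; rewrite ?mulrNN mulr1. Qed.

(** The exchange permutes the two terms of the jump, and eps^2 = 1. *)
Lemma xi_jump_swap i x3 psi xb v xb' v' :
  xi_jump omegac sigma i x3 psi xb' v' xb v =
  - eps i * xi_jump omegac sigma i x3 psi xb v xb' v'.
Proof.
have alg (e a b : R) : e * e = 1 -> b - e * a = - e * (a - e * b).
  by move=> ee; transitivity (- (e * a) + e * e * b); [rewrite ee|]; ring.
by rewrite /xi_jump; exact: alg (epsM i).
Qed.

(** The exchange maps f f' J(ln f) (xi . grad psi) to the other half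
    - eps f f' J(ln f) (xi' . grad' psi') of the symmetric integrand, with the same
    integral. *)
Lemma weak_symmetrized f psi x3 (i : 'I_4) :
  phintegrable2 (weak_integrand omegac sigma i x3 f psi) ->
  phint (fun xb v => phint (fun xb' v' =>
    f (join3 xb x3) v * f (join3 xb' x3) v'
    * xi_jump omegac sigma i x3 (lnf f) xb v xb' v'
    * xi_jump omegac sigma i x3 psi xb v xb' v')) =
  2 * phint (fun xb v => phint (weak_integrand omegac sigma i x3 f psi xb v)).
Proof.
move=> wi; have [si sE] := phint2_swap wi.
have alg (a b e J A B : R) :
    a * b * J * (A - e * B) = a * b * J * A + b * a * (- e * J) * B by ring.
apply: etrans (_ : _ = phint (fun xb v => phint (fun xb' v' =>
    weak_integrand omegac sigma i x3 f psi xb v xb' v'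
    + weak_integrand omegac sigma i x3 f psi xb' v' xb v))) _.
  apply: eq_phint => xb v; apply: eq_phint => xb' v'.
  by rewrite /weak_integrand (xi_jump_swap i x3 (lnf f) xb v); exact: alg.
apply: etrans (phint2D wi si).2 _.
apply: etrans (congr1 _ sE) _.
by rewrite mulr2n mulrDl mul1r.
Qed.

Lemma weak_form f psi x3 : regular omegac sigma f -> C1 psi ->
  decay omegac sigma x3 f psi ->
  phint (fun xb v => avgQ omegac sigma f (join3 xb x3) v * psi (join3 xb x3) v) =
  - (omegac ^+ 2 / 2) * \sum_(i < 4) phint (fun xb v => phint (fun xb' v' =>
    f (join3 xb x3) v * f (join3 xb' x3) v'
    * xi_jump omegac sigma i x3 (lnf f) xb v xb' v'
    * xi_jump omegac sigma i x3 psi xb v xb' v')).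
Proof.
move=> fr C1psi [dd df dw].
have [Di GDi DE] := phint_div6 omegac (diff_flux_x3 omegac sigma f)
  (regular_diff_C1 fr) C1psi dd.
have [Fi GFi FE] := phint_div6 omegac (fric_flux_x3 omegac sigma f)
  (regular_fric_C1 fr) C1psi df.
apply: etrans (_ : _ = phint (fun xb v => omegac ^+ 2 *
    (div6 omegac (diff_flux omegac sigma f) (join3 xb x3) v * psi (join3 xb x3) v
     - div6 omegac (fric_flux omegac sigma f) (join3 xb x3) v * psi (join3 xb x3) v))) _.
  by apply: eq_phint => xb v; rewrite /avgQ -mulrA mulrBl.
have [DFi DFE] := phintB Di Fi.
apply: etrans (phintZ (omegac ^+ 2) DFi).2 _.
apply: etrans (congr1 _ (etrans DFE (congr2 (fun a b => a - b) DE FE))) _.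
have GE := (phintB GDi GFi).2.
have HE : phint (fun xb v =>
    dot (diff_flux omegac sigma f (join3 xb x3) v) (grad omegac psi (join3 xb x3) v)
    - dot (fric_flux omegac sigma f (join3 xb x3) v) (grad omegac psi (join3 xb x3) v)) =
    \sum_(i < 4) phint (fun xb v => phint (weak_integrand omegac sigma i x3 f psi xb v)).
  apply: etrans (phint2_sum (index_enum _) dw).
  apply: eq_phint => xb v; exact: flux_dot.
have TE : \sum_(i < 4) phint (fun xb v => phint (fun xb' v' =>
      f (join3 xb x3) v * f (join3 xb' x3) v'
      * xi_jump omegac sigma i x3 (lnf f) xb v xb' v'
      * xi_jump omegac sigma i x3 psi xb v xb' v')) =
    2 * \sum_(i < 4) phint (fun xb v => phint (weak_integrand omegac sigma i x3 f psi xb v)).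
  by rewrite mulr_sumr; apply: eq_bigr => i _; exact: weak_symmetrized (dw i).
have alg (c a b S T : R) : a - b = S -> T = 2 * S -> c * (- a - - b) = - (c / 2) * T.
  by move=> <- ->; rewrite mulNr mulrA divfK ?pnatr_eq0//; ring.
exact: alg (etrans (esym GE) HE) TE.
Qed.

End symmetrization.

(** * Collision invariants *)

Section velocity_functions.
Local Open Scope classical_set_scope.
Context {R : realType}.
Implicit Types (w : 'cV[R]_3 -> R).

Lemma is_derive_quadratic (c b q : R) :
  is_derive (0 : R) (1 : R) (fun s : R => c + s * b + s ^+ 2 * q) b.
Proof.
have dl (a : R) : is_derive (0 : R) (1 : R) (fun s : R => s * a) a.
  rewrite [X in is_derive _ _ _ X](_ : a = (0 : R) *: (0 : R) + a *: (1 : R)).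
    exact: is_deriveM (is_derive_id (0 : R) (1 : R)) (is_derive_cst a (0 : R) (1 : R)).
  by rewrite scaler0 add0r; exact/esym/mulr1.
have dq : is_derive (0 : R) (1 : R) (fun s : R => s * (s * q)) 0.
  rewrite [X in is_derive _ _ _ X](_ : 0 = (0 : R) *: q + (0 * q) *: (1 : R)).
    exact: is_deriveM (is_derive_id (0 : R) (1 : R)) (dl q).
  by rewrite mul0r !scale0r addr0.
rewrite [X in is_derive _ _ _ X](_ : b = 0 + b + 0); last by rewrite add0r addr0.
rewrite (_ : (fun s => _) = (fun s => c + s * b + s * (s * q))).
  exact: is_deriveD (is_deriveD (is_derive_cst c (0 : R) (1 : R)) (dl b)) dq.
by apply/funext => s /=; rewrite expr2 mulrA.
Qed.

(** Restricted to a line, each of 1, v_3 and |v|^2 / 2 is a polynomial of degree at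
    most two, from which the first derivatives can be read off. *)
Lemma C1_velocity w (b : 'I_3 -> 'cV[R]_3 -> R) (q : 'I_3 -> R) :
  (forall j v s, w (v + s *: delta_mx j 0) = w v + s * b j v + s ^+ 2 * q j) ->
  (forall j, continuous (b j)) ->
  C1 (fun _ => w) /\
  forall omegac x v, grad omegac (fun _ => w) x v = pair6 0 (\col_j b j v).
Proof.
move=> wE cb.
have dw j v : derivable w v (delta_mx j 0) /\ 'D_(delta_mx j 0) w v = b j v.
  have vE : v + (0 : R) *: delta_mx j 0 = v by rewrite scale0r addr0.
  rewrite -[X in derivable w X]vE -[X in 'D__ w X]vE -derivable_line -derive_line.
  rewrite (_ : (fun s => _) = (fun s => w v + s * b j v + s ^+ 2 * q j)).
    by have [] := is_derive_quadratic (w v) (b j v) (q j).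
  by apply/funext => s; exact: wE.
have pdx j x v : pderiv (lshift 3 j) (fun _ => w) x v = 0.
  by rewrite pderivx derive_cst.
have pdv j x v : pderiv (rshift 3 j) (fun _ => w) x v = b j v.
  by rewrite pderivv (dw j v).2.
split=> [k x v|omegac x v].
  case: (split_ordP k) => j ->; split.
  - by rewrite pderivablex; exact: derivable_cst.
  - rewrite (_ : (fun p => _) = (fun=> 0)); first exact: cvg_cst.
    by apply/funext => p; exact: pdx.
  - by rewrite pderivablev; exact: (dw j v).1.
  - rewrite (_ : (fun p => _) = (fun p : 'cV[R]_3 * 'cV[R]_3 => b j p.2)).
      by apply: (continuous_comp (f := snd) (g := b j)); [exact: cvg_snd|exact: cb].
    by apply/funext => p; exact: pdv.
apply/colP => k; rewrite /grad /sderiv mxE.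
case: (split_ordP k) => j ->.
  by rewrite pdx mulr0 /pair6 col_mxEu mxE.
by rewrite pdv /pair6 col_mxEd mxE mul1r.
Qed.

Lemma C1_one : C1 (fun _ _ => 1 : R) /\
  forall omegac x (v : 'cV[R]_3), grad omegac (fun _ _ => 1 : R) x v = pair6 0 0.
Proof.
have [|j|C1one gradE] := @C1_velocity (fun=> 1) (fun _ _ => 0) (fun=> 0).
- by move=> j v s; rewrite !mulr0 !addr0.
- exact: cst_continuous.
split=> // omegac x v; rewrite gradE; congr pair6.
by apply/colP => j; rewrite !mxE.
Qed.

Lemma third_delta (j : 'I_3) : third (delta_mx j 0) = (e3 : 'cV[R]_3) j 0.
Proof.
rewrite /e3 join3E /third !mxE andbT eq_sym.
by case: j => [[|[|[|//]]] ?].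
Qed.

Lemma C1_third : C1 (fun _ v => third v : R) /\
  forall omegac x (v : 'cV[R]_3), grad omegac (fun _ v => third v) x v = pair6 0 e3.
Proof.
have [|j|C1third gradE] :=
  @C1_velocity third (fun j _ => third (delta_mx j 0)) (fun=> 0).
- by move=> j v s; rewrite /third !mxE mulr0 addr0.
- exact: cst_continuous.
split=> // omegac x v; rewrite gradE; congr pair6.
by apply/colP => j; rewrite mxE third_delta.
Qed.

Lemma dot_ge0 n (a : 'cV[R]_n) : 0 <= dot a a.
Proof. by apply: sumr_ge0 => k _; rewrite -expr2 sqr_ge0. Qed.

Lemma enorm2 n (a : 'cV[R]_n) : enorm a ^+ 2 = dot a a.
Proof. by rewrite sqr_sqrtr// dot_ge0. Qed.

Lemma C1_energy : C1 (fun _ v => enorm v ^+ 2 / 2 : R) /\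
  forall omegac x (v : 'cV[R]_3),
    grad omegac (fun _ v => enorm v ^+ 2 / 2) x v = pair6 0 v.
Proof.
have [|j|C1energy gradE] := @C1_velocity (fun v => enorm v ^+ 2 / 2)
  (fun j v => v j 0) (fun=> 2^-1).
- move=> j v s; rewrite !enorm2.
  have -> : dot (v + s *: delta_mx j 0) (v + s *: delta_mx j 0) =
      dot v v + (s * v j 0) *+ 2 + s ^+ 2.
    rewrite /dot (bigD1 j)//= [in RHS](bigD1 j)//= !mxE !eqxx/=.
    rewrite (eq_bigr (fun i => v i 0 * v i 0)) => [|i /negbTE ij]; first by ring.
    by rewrite !mxE ij mulr0 addr0.
  by field.
- exact: coord_continuous.
split=> // omegac x v; rewrite gradE; congr pair6.
by apply/colP => j; rewrite mxE.
Qed.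

End velocity_functions.

Section invariants.
Context {R : realType}.
Context (omegac : R) (sigma : R -> R).
Implicit Types (xb : 'cV[R]_2) (v : 'cV[R]_3).

Lemma dot_pair6 (a b c d : 'cV[R]_3) : dot (pair6 a b) (pair6 c d) = dot a c + dot b d.
Proof.
rewrite /dot big_split_ord; congr (_ + _); apply: eq_bigr => k _.
  by rewrite /pair6 !col_mxEu.
by rewrite /pair6 !col_mxEd.
Qed.

Lemma dot_join3 (w u : 'cV[R]_2) (s t : R) :
  dot (join3 w s) (join3 u t) = dot w u + s * t.
Proof.
rewrite !join3E /dot !big_ord_recr !big_ord0 /= !mxE /= !add0r.
by congr (_ * _ + _ * _ + _); congr (_ _ 0); exact/val_inj.
Qed.

Lemma join3_bar v : join3 (bar v) (third v) = v.
Proof.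
apply/colP => i; rewrite join3E barE !mxE /third.
by case: i => [[|[|[|//]]] ?] /=; congr (v _ _); exact/val_inj.
Qed.

Lemma dot_hor (w : 'cV[R]_2) v : dot (hor w) v = dot w (bar v).
Proof. by rewrite -{1}(join3_bar v) dot_join3 mul0r addr0. Qed.

Lemma dot_e3 v : dot e3 v = third v.
Proof.
rewrite -{1}(join3_bar v) dot_join3 mul1r -[RHS]add0r; congr (_ + _).
by rewrite /dot big1// => k _; rewrite mxE mul0r.
Qed.

Lemma dot_perp (w : 'cV[R]_2) : dot (perp w) w = 0.
Proof.
rewrite /dot !big_ord_recr big_ord0 /= !mxE /= add0r.
rewrite (_ : widen_ord _ _ = 0); last exact/val_inj.
by rewrite (_ : ord_max = 1); [ring|exact/val_inj].
Qed.

Lemma dot0l n (b : 'cV[R]_n) : dot 0 b = 0.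
Proof. by rewrite /dot big1// => k _; rewrite mxE mul0r. Qed.

Lemma dotDl n (a b c : 'cV[R]_n) : dot (a + b) c = dot a c + dot b c.
Proof. by rewrite /dot -big_split/=; apply: eq_bigr => k _; rewrite mxE mulrDl. Qed.

Lemma dotNl n (a c : 'cV[R]_n) : dot (- a) c = - dot a c.
Proof. by rewrite -scaleN1r dotZl mulN1r. Qed.

(** The vector z of the definition of the fields: the difference of the (scaled)
    guiding centres of the two particles. *)
Definition guiding_gap xb v xb' v' : 'cV[R]_2 :=
  omegac *: xb + perp (bar v) - (omegac *: xb' + perp (bar v')).

Definition relative_norm xb v xb' v' : R :=
  Num.sqrt (enorm (guiding_gap xb v xb' v') ^+ 2 + (third v - third v') ^+ 2).

Definition overlap xb v xb' v' : R :=
  chi (enorm (bar v)) (enorm (bar v')) (guiding_gap xb v xb' v').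

Definition amplitude xb v xb' v' : R :=
  Num.sqrt (sigma (relative_norm xb v xb' v') * overlap xb v xb' v').

Definition phase xb v xb' v' : R :=
  angle (enorm (bar v)) (enorm (bar v')) (guiding_gap xb v xb' v').

(** The amplitude and the angle depend on z and v_3 - v_3' only through quantities
    that are even, and are symmetric in r and r'. *)
Lemma enorm_guiding_gap xb v xb' v' :
  enorm (guiding_gap xb' v' xb v) = enorm (guiding_gap xb v xb' v').
Proof.
rewrite /guiding_gap -opprB /enorm; congr Num.sqrt.
by apply: eq_bigr => k _; rewrite mxE mulrNN.
Qed.

Lemma relative_norm_sym xb v xb' v' :
  relative_norm xb' v' xb v = relative_norm xb v xb' v'.
Proof. by rewrite /relative_norm enorm_guiding_gap -[in LHS](sqrrN (_ - _)) opprB. Qed.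

Lemma overlap_sym xb v xb' v' : overlap xb' v' xb v = overlap xb v xb' v'.
Proof.
rewrite /overlap /chi enorm_guiding_gap distrC [_ + enorm (bar v)]addrC.
by rewrite -[in LHS](sqrrN (enorm (bar v') - _)) opprB.
Qed.

Lemma amplitude_sym xb v xb' v' : amplitude xb' v' xb v = amplitude xb v xb' v'.
Proof. by rewrite /amplitude relative_norm_sym overlap_sym. Qed.

Lemma phase_sym xb v xb' v' : phase xb' v' xb v = phase xb v xb' v'.
Proof.
by rewrite /phase /angle enorm_guiding_gap [enorm (bar v') ^+ 2 + _]addrC mulrAC.
Qed.

(** The velocity part of xi^i tested against a vector c, in terms of the
    components e and g of c along bar v / |bar v| and its quarter turn, and of the
    vertical component h of c. *)
Definition xi_dot (i : 'I_4) xb v xb' v' (e g h : R) : R :=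
  let r := enorm (bar v) in
  let r' := enorm (bar v') in
  let nz := enorm (guiding_gap xb v xb' v') in
  let d := third v - third v' in
  let n := relative_norm xb v xb' v' in
  let a := amplitude xb v xb' v' in
  let phi := phase xb v xb' v' in
  match nat_of_ord i with
  | 0 => a * (r' * sin phi * d / (nz * n)) * g
  | 1 => a * ((r - r' * cos phi) / nz * g)
  | 2 => a * (r' * sin phi / nz) * - e
  | _ => a * ((r' * cos phi - r) * d / (nz * n) * - e + n^-1 * - (nz * h))
  end.

Lemma xi_velocity (i : 'I_4) xb v xb' v' (c : 'cV[R]_3) :
  dot (xi omegac sigma i xb v xb' v') (pair6 0 c) =
  xi_dot i xb v xb' v' ((enorm (bar v))^-1 * dot (bar v) (bar c))
    ((enorm (bar v))^-1 * dot (perp (bar v)) (bar c)) (third c).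
Proof.
have pairE (a b : 'cV[R]_3) : dot (pair6 a b) (pair6 0 c) = dot b c.
  by rewrite dot_pair6 [dot a 0]dotC dot0l add0r.
have horE s w : dot (s *: hor w) c = s * dot w (bar c) by rewrite dotZl dot_hor.
have h0 k a b : dot (k *: pair6 a b) (pair6 0 c) = k * dot b c.
  by rewrite dotZl pairE.
have h1 k l a b a' b' : dot (k *: (l *: pair6 a b + pair6 a' b')) (pair6 0 c) =
    k * (l * dot b c + dot b' c) by rewrite dotZl dotDl dotZl !pairE.
have h3 k l m a b a' b' : dot (k *: (l *: pair6 a b + m *: pair6 a' b')) (pair6 0 c) =
    k * (l * dot b c + m * dot b' c) by rewrite dotZl dotDl !dotZl !pairE.
have e3E s : dot (- (s *: e3)) c = - (s * third c) by rewrite dotNl dotZl dot_e3.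
have NhorE s w : dot (- (s *: hor w)) c = - (s * dot w (bar c)).
  by rewrite dotNl horE.
rewrite /xi /xi_dot; case: i => [[|[|[|[|//]]]] ?] /=.
- by apply: etrans (h0 _ _ _) _; congr (_ * _); exact: horE.
- apply: etrans (h1 _ _ _ _ _ _) _; congr (_ * _).
  by apply: etrans (congr2 (fun a b => _ * a + b) (horE _ _) (dot0l c)) _; rewrite addr0.
- by apply: etrans (h0 _ _ _) _; congr (_ * _); exact: NhorE.
- apply: etrans (h3 _ _ _ _ _ _ _) _; congr (_ * _).
  by apply: etrans (congr2 (fun a b => _ * a + _ * b) (NhorE _ _) (e3E _)) _.
Qed.

(** Where the fields do not vanish, r, r' and |z| are the sides of a nondegenerate
    triangle with angle phi opposite to z. *)
Lemma amplitude_neq0 xb v xb' v' : amplitude xb v xb' v' != 0 ->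
  0 < enorm (guiding_gap xb v xb' v') /\
  enorm (guiding_gap xb v xb' v') ^+ 2 = enorm (bar v) ^+ 2 + enorm (bar v') ^+ 2
    - 2 * enorm (bar v) * enorm (bar v') * cos (phase xb v xb' v').
Proof.
rewrite /amplitude /overlap /chi; case: ifP => [/andP[lo up] _|]; last first.
  by rewrite mulr0 sqrtr0 eqxx.
by split; [exact: le_lt_trans lo|have [_] := angleP lo up].
Qed.

(** The vector c = p e_3 + b v has no component along the quarter turn of bar v,
    which settles the first two fields.  For the third, both terms equal
    - b a r r' sin phi / |z|.  For the fourth, the multiples of p cancel by symmetry
    and those of b combine into the law of cosines. *)
Lemma xi_jump_invariant i x3 (psi : 'cV[R]_3 -> 'cV[R]_3 -> R) (p b : R)
    xb v xb' v' :
  (forall x w, grad omegac psi x w = pair6 0 (p *: e3 + b *: w)) ->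
  xi_jump omegac sigma i x3 psi xb v xb' v' = 0.
Proof.
move=> gradE.
have barc w : bar (p *: e3 + b *: w) = b *: bar w.
  have -> : bar (p *: e3 + b *: w) = p *: bar e3 + b *: bar w.
    by apply/colP => k; rewrite !mxE.
  by rewrite bar_join3 scaler0 add0r.
have thirdc w : third (p *: e3 + b *: w) = p + b * third w.
  have -> : third (p *: e3 + b *: w) = p * third e3 + b * third w.
    by rewrite /third !mxE.
  by rewrite third_join3 mulr1.
(* also for r = 0, as r^-1 = 0 then *)
have rE (r : R) : r^-1 * (b * r ^+ 2) = b * r.
  by have [->|r0] := eqVneq r 0; rewrite ?expr0n ?mulr0// mulrCA expr2 mulKf.
have dotE y w y' w' : dot (xi omegac sigma i y w y' w') (grad omegac psi (join3 y x3) w) =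
    xi_dot i y w y' w' (b * enorm (bar w)) 0 (p + b * third w).
  rewrite gradE xi_velocity barc thirdc !dotZr dot_perp !mulr0.
  by rewrite -enorm2 rE.
apply: etrans (congr2 (fun A B => A - eps i * B) (dotE _ _ _ _) (dotE _ _ _ _)) _.
rewrite /xi_dot (relative_norm_sym xb v) (amplitude_sym xb v) (phase_sym xb v)
  (enorm_guiding_gap xb v).
have := @amplitude_neq0 xb v xb' v'; move: (amplitude _ _ _ _) => a.
rewrite /relative_norm; move: (enorm (guiding_gap _ _ _ _)) (phase _ _ _ _) => z phi.
move: (enorm (bar v)) (enorm (bar v')) (third v) (third v') => r r' v3 v3' aP.
(* closed by computation for all fields but the fourth *)
case: i {dotE} => [[|[|[|[|//]]]] ?]; rewrite /eps /= ?mulr0 ?subr0//; first by ring.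
have [->|a0] := eqVneq a 0; first by rewrite !mul0r mulr0 subrr.
have [z0 zE] := aP a0; rewrite -[v3' - v3]opprB.
have n0 : Num.sqrt (z ^+ 2 + (v3 - v3') ^+ 2) != 0.
  by rewrite gt_eqF// sqrtr_gt0 ltr_pwDl ?sqr_ge0// exprn_gt0.
move: (Num.sqrt _) n0 => n n0; move/lt0r_neq0 in z0.
transitivity (a * b / (z * n) * (v3 - v3') *
    (r ^+ 2 + r' ^+ 2 - 2 * r * r' * cos phi - z ^+ 2)).
  by field; rewrite n0 z0.
by rewrite -zE subrr mulr0.
Qed.

End invariants.

(** * Balance laws and decrease of the entropy *)

Section balances.
Context {R : realType}.
Context (omegac : R) (sigma : R -> R) (f : 'cV[R]_3 -> 'cV[R]_3 -> R).
Context (f_regular : regular omegac sigma f).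

Lemma collision_invariant_balance (psi : 'cV[R]_3 -> 'cV[R]_3 -> R) (p b x3 : R) :
  C1 psi -> (forall x w, grad omegac psi x w = pair6 0 (p *: e3 + b *: w)) ->
  decay omegac sigma x3 f psi ->
  phint (fun xb v =>
    psi (join3 xb x3) v * avgQ omegac sigma f (join3 xb x3) v) = 0.
Proof.
move=> C1psi gradE dec.
apply: etrans (eq_phint (fun _ _ => mulrC _ _)) _.
apply: etrans (weak_form f_regular C1psi dec) _.
rewrite big1 ?mulr0// => i _.
apply: etrans (@eq_phint R _ (fun _ _ => 0) _) phint0 => xb v.
apply: etrans (@eq_phint R _ (fun _ _ => 0) _) phint0 => xb' v'.
by apply: etrans (congr1 _ (xi_jump_invariant sigma i x3 xb v xb' v' gradE)) _; rewrite mulr0.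
Qed.

Lemma entropy_decreases (x3 : R) : decay omegac sigma x3 f (lnf f) ->
  phint (fun xb v =>
    lnf f (join3 xb x3) v * avgQ omegac sigma f (join3 xb x3) v) <= 0.
Proof.
move=> dec; have f0 := regular_pos f_regular.
have C1lnf := C1_lnf f0 (regular_smooth f_regular).
have -> : phint (fun xb v =>
    lnf f (join3 xb x3) v * avgQ omegac sigma f (join3 xb x3) v) =
    phint (fun xb v =>
    avgQ omegac sigma f (join3 xb x3) v * lnf f (join3 xb x3) v).
  by apply: eq_phint => xb v; exact: mulrC.
rewrite (weak_form f_regular C1lnf dec).
rewrite mulNr oppr_le0 mulr_ge0 ?divr_ge0 ?sqr_ge0//.
apply: sumr_ge0 => i _; apply: phint_ge0 => xb v; apply: phint_ge0 => xb' v'.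
by rewrite -mulrA -expr2 mulr_ge0 ?sqr_ge0// mulr_ge0// ltW.
Qed.

End balances.

Theorem proposition5p10 (R : realType) (omegac : R) (sigma : R -> R)
    (f : 'cV[R]_3 -> 'cV[R]_3 -> R)
    (omegac_neq0 : omegac != 0)
    (sigma_ge0 : forall s : R, 0 <= s -> 0 <= sigma s)
    (f_regular : regular omegac sigma f) :
  (forall (psi : 'cV[R]_3 -> 'cV[R]_3 -> R) (x3 : R),
     smooth psi -> decay omegac sigma x3 f psi ->
     phint (fun xb v =>
       avgQ omegac sigma f (join3 xb x3) v * psi (join3 xb x3) v) =
     - (omegac ^+ 2 / 2) *
       \sum_(i < 4) phint (fun xb v => phint (fun xb' v' =>
         f (join3 xb x3) v * f (join3 xb' x3) v'
         * xi_jump omegac sigma i x3 (lnf f) xb v xb' v'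
         * xi_jump omegac sigma i x3 psi xb v xb' v')))
  /\ (forall x3 : R, decay omegac sigma x3 f (fun _ _ => 1) ->
        phint (fun xb v => 1 * avgQ omegac sigma f (join3 xb x3) v) = 0)
  /\ (forall x3 : R, decay omegac sigma x3 f (fun _ v => third v) ->
        phint (fun xb v =>
          third v * avgQ omegac sigma f (join3 xb x3) v) = 0)
  /\ (forall x3 : R, decay omegac sigma x3 f (fun _ v => enorm v ^+ 2 / 2) ->
        phint (fun xb v =>
          enorm v ^+ 2 / 2 * avgQ omegac sigma f (join3 xb x3) v) = 0)
  /\ (forall x3 : R, decay omegac sigma x3 f (lnf f) ->
        phint (fun xb v =>
          lnf f (join3 xb x3) v * avgQ omegac sigma f (join3 xb x3) v) <= 0).
Proof.
split; first by move=> psi x3 /smooth_C1; exact: weak_form.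
split; [|split; [|split]] => x3 dec.
- have [C1psi gradE] := @C1_one R.
  apply: (collision_invariant_balance f_regular (p := 0) (b := 0) C1psi) dec => x w.
  by rewrite gradE !scale0r addr0.
- have [C1psi gradE] := @C1_third R.
  apply: (collision_invariant_balance f_regular (p := 1) (b := 0) C1psi) dec => x w.
  by rewrite gradE scale1r scale0r addr0.
- have [C1psi gradE] := @C1_energy R.
  apply: (collision_invariant_balance f_regular (p := 0) (b := 1) C1psi) dec => x w.
  by rewrite gradE scale1r scale0r add0r.
- exact: entropy_decreases.
Qed.
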